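(* Let $0<\alpha<1$, $0<\tilde\alpha<1$, $\rho>0$, $\eta\ge 0$, and let $\mathcal H$ and $\mathcal A$ be the Hilbert space and operator defined in the context. If $$\tilde\alpha<\frac{4-3\alpha}{2(2-\alpha)},$$ then the $C_0$-semigroup generated by $\mathcal A$ on $\mathcal H$ is not exponentially stable, i.e. there are no constants $M,\omega>0$ such that $\|e^{t\mathcal A}\|_{\mathcal L(\mathcal H)}\le Me^{-\omega t}$ for all $t\ge 0$.
   Context: All functions are complex valued and $\imath$ is the imaginary unit. Define $$H^1_\alpha(0,1)=\{v\in L^2(0,1): v \text{ locally absolutely continuous in }(0,1],\ x^{\alpha/2}v_x\in L^2(0,1)\},$$ $$H^2_\alpha(0,1)=\{v\in H^1_\alpha(0,1): x^\alpha v_x\in H^1(0,1)\}.$$ Since $0<\alpha<1$, $H^1_\alpha(0,1)\hookrightarrow C([0,1])$, so $v(0)$ makes sense for $v\in H^1_\alpha(0,1)$; also $(x^\alpha v_x)(0)$ and $v_x(1)$ make sense for $v\in H^2_\alpha(0,1)$. Let $\mu(\xi)=|\xi|^{(2\tilde\alpha-1)/2}$ for $\xi\in\mathbb R$, and $\zeta=\rho\,\pi^{-1}\sin(\tilde\alpha\pi)$. Let $\mathcal H=L^2(0,1)\times L^2(\mathbb R)$ with inner product $$\langle (v,\phi),(\tilde v,\tilde\phi)\rangle_{\mathcal H}=\int_0^1 v\,\overline{\tilde v}\,dx+\zeta\int_{-\infty}^{+\infty}\phi(\xi)\overline{\tilde\phi(\xi)}\,d\xi.$$ The operator $\mathcal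 A$ is $$\mathcal A\begin{pmatrix}v\\ \phi\end{pmatrix}=\begin{pmatrix}-\imath(x^\alpha v_x)_x\\ -(\xi^2+\eta)\phi+\mu(\xi)v(0)\end{pmatrix}$$ with domain $D(\mathcal A)$ the set of all $(v,\phi)\in\mathcal H$ such that $v\in H^2_\alpha(0,1)$, $v_x(1)=0$, $(x^\alpha v_x)(0)=\imath\zeta\int_{-\infty}^{\infty}\mu(\xi)\phi(\xi)\,d\xi$, $-(\xi^2+\eta)\phi+\mu(\xi)v(0)\in L^2(\mathbb R)$ and $|\xi|\phi\in L^2(\mathbb R)$. The operator $\mathcal A$ generates a $C_0$-semigroup of contractions on $\mathcal H$, denoted $e^{t\mathcal A}$. *)

(* Defs.v *)
From HB Require Import structures.
From mathcomp Require Import all_boot all_order all_algebra.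
From mathcomp Require Import ring_quotient.
From mathcomp Require Import all_classical all_reals all_analysis.
From mathcomp Require Import measurable_realfun complex.
From mathcomp Require Import ring.

Set Implicit Arguments.
Unset Strict Implicit.
Unset Printing Implicit Defensive.

Import Order.TTheory GRing.Theory Num.Theory.
Import numFieldNormedType.Exports.
Import Normc.

Local Open Scope classical_set_scope.
Local Open Scope quotient_scope.
Local Open Scope ring_scope.
Local Open Scope complex_scope.

Section normc.
Context (R : realType).

Lemma normc2E (z : R[i]) :
  normc z ^+ 2 = complex.Re z ^+ 2 + complex.Im z ^+ 2.
Proof. by case: z => a b /=; rewrite sqr_sqrtr// addr_ge0 ?sqr_ge0. Qed.

Lemma normc_ge0 (z : R[i]) : 0 <= normc z.
Proof. by case: z => a b; exact: sqrtr_ge0. Qed.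

Lemma measurable_normc2 d (T : measurableType d) (D : set T) (f : T -> R[i]) :
    measurable_fun D (fun x => complex.Re (f x)) ->
    measurable_fun D (fun x => complex.Im (f x)) ->
  measurable_fun D (fun x => normc (f x) ^+ 2 : R).
Proof.
move=> mr mi; rewrite (_ : (fun x => _) =
    (fun x => complex.Re (f x) ^+ 2 + complex.Im (f x) ^+ 2)).
  by apply: measurable_funD; exact: measurable_funX.
by apply/funext => x; rewrite normc2E.
Qed.

End normc.

Section L2.
Context d (T : measurableType d) (R : realType).
Variables (mu : {measure set T -> \bar R}) (D : set T) (mD : measurable D).

Definition square_integrable (f : T -> R[i]) : Prop :=
  [/\ measurable_fun D (fun x => complex.Re (f x)),
      measurable_fun D (fun x => complex.Im (f x))
    & mu.-integrable D (fun x => (normc (f x) ^+ 2 : R)%:E)].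

(* the measurability of [D] is an argument, for the predicate to be canonically
   closed under linear combinations *)
Definition L2pred (_ : measurable D) : {pred T -> R[i]} :=
  mem [set f | square_integrable f].

Lemma L2predP f : reflect (square_integrable f) (f \in L2pred mD).
Proof. exact: asboolP. Qed.

Lemma L2pred_submod_closed : submod_closed (L2pred mD).
Proof.
split=> [|a f g /L2predP[mfr mfi If] /L2predP[mgr mgi Ig]]; apply/L2predP.
  split; [exact: measurable_cst|exact: measurable_cst|].
  rewrite (_ : (fun x => _) = cst 0%E); first exact: integrable0.
  by apply/funext => x; rewrite normc0 expr0n.
have RE x : complex.Re ((a *: f + g) x) = complex.Re a * complex.Re (f x)
    - complex.Im a * complex.Im (f x) + complex.Re (g x).
  rewrite [(a *: f + g) x]/(a * f x + g x).
  by move: (f x) (g x) => [? ?] [? ?]; case: (a).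
have IE x : complex.Im ((a *: f + g) x) = complex.Re a * complex.Im (f x)
    + complex.Im a * complex.Re (f x) + complex.Im (g x).
  rewrite [(a *: f + g) x]/(a * f x + g x).
  by move: (f x) (g x) => [? ?] [? ?]; case: (a).
have mr : measurable_fun D (fun x => complex.Re ((a *: f + g) x)).
  under eq_fun do rewrite RE.
  by apply: measurable_funD => //; apply: measurable_funB;
    apply: measurable_funM => //; exact: measurable_cst.
have mi : measurable_fun D (fun x => complex.Im ((a *: f + g) x)).
  under eq_fun do rewrite IE.
  by apply: measurable_funD => //; apply: measurable_funD;
    apply: measurable_funM => //; exact: measurable_cst.
split=> //.
pose h x := ((2 * normc a ^+ 2 : R)%:E * (normc (f x) ^+ 2 : R)%:E
             + (2 : R)%:E * (normc (g x) ^+ 2 : R)%:E)%E.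
apply: (@le_integrable _ _ _ mu D mD _ h).
- exact/measurable_EFinP/measurable_normc2.
- move=> x _; rewrite /h -!EFinM -EFinD/= lee_fin ger0_norm ?sqr_ge0//.
  apply: le_trans (ler_norm _).
  rewrite [(a *: f + g) x]/(a * f x + g x).
  rewrite -mulrA -exprMn -normcM -mulrDr.
  have nD := le_normcD (a * f x) (g x).
  apply: (@le_trans _ _ ((normc (a * f x) + normc (g x)) ^+ 2)).
    by rewrite lerXn2r// ?nnegrE ?addr_ge0 ?normc_ge0.
  rewrite -subr_ge0.
  rewrite (_ : _ - _ = (normc (a * f x) - normc (g x)) ^+ 2) ?sqr_ge0//.
  by rewrite sqrrB sqrrD mulr_natl !mulr2n !opprD; ring.
- by apply: integrableD => //; exact: integrableZl.
Qed.

HB.instance Definition _ :=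
  GRing.isSubmodClosed.Build _ _ (L2pred mD) L2pred_submod_closed.

Record L2fun := MkL2fun { l2fun :> T -> R[i]; _ : l2fun \in L2pred mD }.
HB.instance Definition _ := [isSub for l2fun].
HB.instance Definition _ := [Choice of L2fun by <:].
HB.instance Definition _ := [SubChoice_isSubLmodule of L2fun by <:].

Definition L2null : {pred L2fun} :=
  mem [set f : L2fun | (f : T -> R[i]) = cst 0 %[ae mu in D]].

Lemma L2nullP (f : L2fun) :
  reflect ((f : T -> R[i]) = cst 0 %[ae mu in D]) (f \in L2null).
Proof. exact: asboolP. Qed.

Lemma L2null_submod_closed : submod_closed L2null.
Proof.
split=> [|a f g /L2nullP f0 /L2nullP g0]; apply/L2nullP.
  exact: aeW.
apply: filterS2 f0 g0 => x f0 g0 Dx.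
have -> : l2fun (a *: f + g) x = a * l2fun f x + l2fun g x by [].
by rewrite (f0 Dx) (g0 Dx) addr0 mulr0.
Qed.

HB.instance Definition _ :=
  GRing.isSubmodClosed.Build _ _ L2null L2null_submod_closed.

Definition L2 : Type := Quotient.quot L2null.
HB.instance Definition _ := GRing.Zmodule.on L2.
HB.instance Definition _ := EqQuotient.on L2.

Definition L2scale (a : R[i]) (u : L2) : L2 := \pi_L2 (a *: repr u).

Lemma L2_piZ a (f : L2fun) : L2scale a (\pi_L2 f) = \pi_L2 (a *: f).
Proof.
apply/eqP; rewrite /L2scale -Quotient.idealrBE -scalerBr rpredZ//.
by rewrite Quotient.idealrBE reprK.
Qed.

Lemma L2_piD (f g : L2fun) : \pi_L2 (f + g) = \pi_L2 f + \pi_L2 g.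
Proof. exact: Quotient.pi_add. Qed.

Lemma L2scalerA a b u : L2scale a (L2scale b u) = L2scale (a * b) u.
Proof. by rewrite -[u]reprK (L2_piZ b) (L2_piZ a) L2_piZ scalerA. Qed.

Lemma L2scale1r : left_id 1 L2scale.
Proof. by move=> u; rewrite -[u]reprK L2_piZ scale1r. Qed.

Lemma L2scalerDr : right_distributive L2scale +%R.
Proof.
by move=> a u v; rewrite -[u]reprK -[v]reprK -L2_piD !(L2_piZ a) -L2_piD scalerDr.
Qed.

Lemma L2scalerDl u : {morph L2scale^~ u : a b / a + b}.
Proof. by move=> a b; rewrite -[u]reprK (L2_piZ a) (L2_piZ b) L2_piZ -L2_piD scalerDl. Qed.

HB.instance Definition _ :=
  GRing.Zmodule_isLmodule.Build R[i] L2 L2scalerA L2scale1r L2scalerDr L2scalerDl.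

Definition L2rep (u : L2) : T -> R[i] := l2fun (repr u).

Definition cintegral (f : T -> R[i]) : R[i] :=
  (\int[mu]_(x in D) complex.Re (f x)) +i* (\int[mu]_(x in D) complex.Im (f x)).

End L2.

Section semigroups.
Context (R : realType) (V : lmodType R[i]) (nrm : V -> R).
Implicit Types (S : V -> V) (T : R -> V -> V) (A : V -> V -> Prop).

Definition opnorm S : \bar R :=
  ereal_sup [set (nrm (S u))%:E | u in [set u | nrm u <= 1]].

(* the values of [T] at negative times are irrelevant *)
Definition C0_semigroup T : Prop :=
  [/\ forall t, 0 <= t -> linear (T t) /\ (opnorm (T t) < +oo)%E,
      forall u, T 0 u = u,
      forall s t u, 0 <= s -> 0 <= t -> T (s + t) u = T s (T t u)
    & forall u, nrm (T t u - u) @[t --> 0^'+] --> (0 : R)].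

(* Unbounded operators are given by their graphs: [A u f] means that [u] is in
   the domain of [A] and that [A] maps [u] to [f]. *)
Definition generator T (u f : V) : Prop :=
  nrm ((t^-1)%:C *: (T t u - u) - f) @[t --> 0^'+] --> (0 : R).

Definition generates A T : Prop :=
  C0_semigroup T /\ forall u f, generator T u f <-> A u f.

Definition exponentially_stable T : Prop :=
  exists M omega : R, [/\ 0 < M, 0 < omega &
    forall t, 0 <= t -> (opnorm (T t) <= (M * expR (- omega * t))%:E)%E].

End semigroups.

Section functions_on_an_interval.
Context (R : realType).
Implicit Types (a b x : R) (f : R -> R[i]).

Definition abs_continuous a b f : Prop :=
  forall e : R, 0 < e -> exists2 d : R, 0 < d &
    forall (n : nat) (s t : 'I_n -> R),
      (forall i, [/\ a <= s i, s i <= t i & t i <= b]) ->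
      (forall i j, i != j -> t i <= s j \/ t j <= s i) ->
      \sum_(i < n) (t i - s i) < d ->
      \sum_(i < n) (normc (f (t i) - f (s i)) : R) < e.

Definition cderive f x : R[i] :=
  ((fun y => complex.Re (f y))^`()%classic x)
  +i* ((fun y => complex.Im (f y))^`()%classic x).

Definition I01 : set (measurableTypeR R) := `]0, 1[.
Lemma measurable_I01 : measurable I01. Proof. exact: measurable_itv. Qed.

Definition L2_01 : Type := L2 (@lebesgue_measure R) measurable_I01.
Definition L2_R : Type := L2 (@lebesgue_measure R) (@measurableT _ (measurableTypeR R)).

Definition in_L2_01 f : Prop := square_integrable (@lebesgue_measure R) I01 f.
Definition in_L2_R f : Prop := square_integrable (@lebesgue_measure R) setT f.

HB.instance Definition _ := GRing.Lmodule.on L2_01.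
HB.instance Definition _ := GRing.Lmodule.on L2_R.

Definition in_H1 f : Prop :=
  [/\ in_L2_01 f, abs_continuous 0 1 f & in_L2_01 (cderive f)].

(* [f] is the representative of an element of H^1_alpha(0,1) that is continuous
   on [0,1]; in particular the trace at 0 of this element is [f 0]. *)
Definition in_H1_alpha (alpha : R) f : Prop :=
  [/\ in_L2_01 f,
      forall a, 0 < a -> a < 1 -> abs_continuous a 1 f,
      in_L2_01 (fun x => (x `^ (alpha / 2))%:C * cderive f x)
    & normc (f x - f 0) @[x --> 0^'+] --> (0 : R)].

(* [g] is the representative of x^alpha f_x that is continuous on [0,1], so that
   (x^alpha f_x)(0) is [g 0] and f_x(1) = (x^alpha f_x)(1) is [g 1]. *)
Definition in_H2_alpha (alpha : R) f g : Prop :=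
  [/\ in_H1_alpha alpha f, in_H1 g &
      g = (fun x => (x `^ alpha)%:C * cderive f x)
        %[ae (@lebesgue_measure R) in I01]].

End functions_on_an_interval.

Section operator.
Context (R : realType) (alpha talpha rho eta : R).

Definition mu_weight (xi : R) : R := `|xi| `^ ((2 * talpha - 1) / 2).

Definition zeta : R := rho * pi^-1 * sin (talpha * pi).

Definition Hspace : Type := (L2_01 R * L2_R R)%type.
HB.instance Definition _ := GRing.Lmodule.on Hspace.
Implicit Types u f : Hspace.

Definition Hinner u f : R[i] :=
  cintegral (@lebesgue_measure R) (@I01 R)
    (fun x => L2rep u.1 x * (L2rep f.1 x)^*%C)
  + zeta%:C * cintegral (@lebesgue_measure R) setT
    (fun xi => L2rep u.2 xi * (L2rep f.2 xi)^*%C).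

Definition Hnorm u : R := Num.sqrt (complex.Re (Hinner u u)).

Definition phi_part (w : R -> R[i]) (phi : R -> R[i]) (xi : R) : R[i] :=
  - (xi ^+ 2 + eta)%:C * phi xi + (mu_weight xi)%:C * w 0.

(* [u] = (v, phi) is in the domain, [w] and [g] being the continuous
   representatives of v and x^alpha v_x *)
Definition domA u (w g : R -> R[i]) : Prop :=
  [/\ L2rep u.1 = w %[ae (@lebesgue_measure R) in (@I01 R)],
      in_H2_alpha alpha w g,
      g 1 = 0,
      g 0 = 'i%C * zeta%:C * cintegral (@lebesgue_measure R) setT
              (fun xi => (mu_weight xi)%:C * L2rep u.2 xi) &
      in_L2_R (phi_part w (L2rep u.2)) /\
      in_L2_R (fun xi => `|xi|%:C * L2rep u.2 xi)].

Definition opA u f : Prop := exists w g : R -> R[i],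
  [/\ domA u w g,
      L2rep f.1 = (fun x => - 'i%C * cderive g x)
        %[ae (@lebesgue_measure R) in (@I01 R)]
    & L2rep f.2 = phi_part w (L2rep u.2) %[ae (@lebesgue_measure R)]].

End operator.

(* Main.v *)
Require Import Defs.
From HB Require Import structures.
From mathcomp Require Import all_boot all_order all_algebra ring_quotient.
From mathcomp Require Import all_classical all_reals all_analysis.
From mathcomp Require Import measurable_realfun complex.
From mathcomp Require Import ring lra.

(** Exponential stability bounds the resolvent of the generator along the
    imaginary axis ([resolvent_lower_bound]).  It is therefore refuted by
    quasimodes: elements U of the domain, of arbitrarily high frequency omega,
    for which (A - i omega) U is small relative to U.

    Put beta = 2 - alpha and let F solve (y^alpha F')' = - F on the half-line
    with F(0) = 1 and no flux at 0.  Then F(r x) satisfies the interior equation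
    with omega = r^beta, and the condition at x = 1 as soon as the flux
    p = y^alpha F' vanishes at r, which happens for arbitrarily large r
    ([flux_zero]).  The memory equation is solved exactly by
    phi = mu v(0) / (xi^2 + eta + i omega).  This phi requires at x = 0 a flux b
    of size omega^(talpha - 1) ([memory_flux_le]), whereas F has none.  The
    missing flux is carried by b times a corrector: the second solution G of the
    oscillator, which has unit flux at 0, plus a multiple of y F', chosen so that
    the flux at r vanishes again.  As y F' comes from differentiating F(r x) in
    r, it fails the equation only by a multiple of F, and the residual of the
    whole quasimode is b beta / F(r)^2 times F(r x) ([corrected_modes]).  Testing
    against F(r x) shows that no residual can be of smaller order.

    It remains to bound F(r) from below.  The WKB heuristic predicts
    |F(r)| of order r^(- alpha / 4), and exactly this bound is needed.  Here it
    comes from a quantity built from the energy, corrected to second order, which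
    is nondecreasing and equals r^(alpha / 2) F(r)^2 where the flux vanishes
    ([amplitude_lower_bound]).  The relative size of the residual is then at most
    of order omega^(talpha - 1) r^(alpha / 2) = r^(beta (talpha - 1) + alpha / 2),
    and this exponent is negative precisely when
    talpha < (4 - 3 alpha) / (2 (2 - alpha)). *)

Set Implicit Arguments.
Unset Strict Implicit.
Unset Printing Implicit Defensive.

Import Order.TTheory GRing.Theory Num.Theory.
Import numFieldNormedType.Exports.
Import Normc.

Local Open Scope classical_set_scope.
Local Open Scope ring_scope.

(** * Resolvent bounds from exponential stability *)

Section semigroup.
Context (R : realType) (V : lmodType R[i]) (nrm : V -> R).
Hypothesis nrmD : forall u v, nrm (u + v) <= nrm u + nrm v.
Hypothesis nrmZ : forall c u, nrm (c *: u) = normc c * nrm u.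
Hypothesis nrm_ge0 : forall u, 0 <= nrm u.

(** The norm is only a seminorm here, so the case [nrm u = 0] needs its own
    argument: all multiples of [u] lie in the unit ball, which forces
    [nrm (S u) = 0]. *)
Lemma nrm_opnorm (S : V -> V) (K : R) u : linear S ->
  (opnorm nrm S <= K%:E)%E -> nrm (S u) <= K * nrm u.
Proof.
move=> linS SK.
have SZ c v : S (c *: v) = c *: S v.
  have S0 : S 0 = 0.
    have := linS (-1) 0 0; rewrite scaler0 addr0 scaleN1r.
    by move=> ->; rewrite addNr.
  by have := linS c v 0; rewrite addr0 S0 addr0.
have unit_bound v : nrm v <= 1 -> nrm (S v) <= K.
  move=> v1; rewrite -lee_fin; apply: le_trans SK.
  by apply: ereal_sup_ubound; exists v.
have K0 : 0 <= K.
  apply: (le_trans (nrm_ge0 (S 0))); apply: unit_bound.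
  by rewrite -(scale0r (0 : V)) nrmZ normc0 mul0r.
have normcR (r : R) : 0 <= r -> normc (r%:C)%C = r.
  by move=> r0; rewrite /= expr0n addr0 sqrtr_sqr ger0_norm.
have [u0|u0] := eqVneq (nrm u) 0.
  rewrite u0 mulr0 leNgt; apply/negP => Su0.
  have c0 : 0 <= (K + 1) / nrm (S u) by rewrite divr_ge0 ?addr_ge0.
  have := unit_bound ((((K + 1) / nrm (S u))%:C)%C *: u).
  rewrite SZ !nrmZ u0 mulr0 ler01 normcR// divfK ?gt_eqF// => /(_ isT).
  by rewrite gerDl ler10.
have up : 0 < nrm u by rewrite lt_def u0 nrm_ge0.
have c0 : 0 <= (nrm u)^-1 by rewrite invr_ge0 ltW.
have := unit_bound ((((nrm u)^-1)%:C)%C *: u).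
rewrite SZ !nrmZ normcR// mulVf// lexx => /(_ isT).
by rewrite mulrC ler_pdivrMr.
Qed.

(** Let c = (1 + i l h)^-1, a contraction that approximates exp(- i l h).  The
    telescoping identity for (c T(h))^n u - u, with n h = t fixed and h tending to
    0, bounds [nrm u] by the norm of T(t) u plus t M times the norm of
    f - i l u; the first term is absorbed once t is large.  Working with c
    rather than with the exponential makes the increment c T(h) u - u an exact
    multiple of T(h) u - u - i l h u. *)
Lemma resolvent_lower_bound (A : V -> V -> Prop) (T : R -> V -> V) :
  generates nrm A T -> exponentially_stable nrm T ->
  exists2 C : R, 0 < C & forall (l : R) u f, A u f ->
    nrm u <= C * nrm (f - (0 +i* l)%C *: u).
Proof.
move=> [[Tlin T0 TD _] genT] [M [w [M0 w0 TM]]].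
have Tle t u : 0 <= t -> nrm (T t u) <= M * expR (- w * t) * nrm u.
  by move=> t0; apply: nrm_opnorm; [exact: (Tlin t t0).1|exact: TM].
have nrmN u : nrm (- u) = nrm u.
  by rewrite -scaleN1r nrmZ normcN normc1 mul1r.
(* this time makes M exp(- w t) smaller than 1 / 2 *)
pose t := ln (2 * M + 1) / w.
have t0 : 0 < t by rewrite divr_gt0// ln_gt0// ltrDr mulr_gt0.
have Mt : M * expR (- w * t) <= 2^-1.
  rewrite mulNr /t mulrCA divff ?gt_eqF// mulr1 expRN lnK; last first.
    by rewrite posrE addr_gt0// mulr_gt0.
  rewrite ler_pdivrMr ?addr_gt0 ?mulr_gt0// mulrDr mulrA mulVf// mul1r mulr1.
  by rewrite lerDl.
have TleM s u : 0 <= s -> nrm (T s u) <= M * nrm u.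
  move=> s0; apply: (le_trans (Tle _ _ s0)); rewrite ler_wpM2r//.
  rewrite (ler_piMr (ltW M0))// -expR0 ler_expR mulNr oppr_le0.
  by rewrite mulr_ge0// ltW.
clearbody t.
exists (2 * t * M); first by rewrite ?mulr_gt0 ?ltr0n.
move=> l u f /(genT u f).2 Auf.
set r := nrm (f - _).
suff H e : 0 < e -> nrm u <= 2^-1 * nrm u + t * M * (e + r).
  apply/ler_addgt0Pr => e e0.
  have tM : 0 < 2 * (t * M) by rewrite ?mulr_gt0 ?ltr0n.
  have /H : 0 < e / (2 * (t * M)) by rewrite divr_gt0.
  rewrite -subr_ge0 mulrDr.
  rewrite (_ : t * M * (e / (2 * (t * M))) = e / 2); first by lra.
  by field; rewrite ?gt_eqF.
move=> e0.
have /cvgrPdist_lt/(_ e e0) := Auf.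
move=> [d /= d0 dP].
have [n nd] : exists n, t / n.+1%:R < d.
  have [n _ /(_ _ (leqnn n)) nP] := near_infty_natSinv_lt (PosNum (divr_gt0 d0 t0)).
  by exists n; rewrite mulrC -ltr_pdivlMr.
set h := t / n.+1%:R in nd.
have h0 : 0 < h by rewrite divr_gt0.
have hn : n.+1%:R * h = t by rewrite mulrC divfK.
clearbody h.
pose il := (0 +i* l)%C.
pose c : R[i] := (1 + (h%:C)%C * il)^-1.
have normc_ge1 : 1 <= normc (1 + (h%:C)%C * il).
  rewrite /il; simpc => /=; rewrite -[leLHS]sqrtr1 ler_wsqrtr//.
  by rewrite ?addr0 expr1n lerDl sqr_ge0.
have c1 : normc c <= 1.
  rewrite /c normcV invf_le1//; exact: lt_le_trans ltr01 normc_ge1.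
have cK : c * (1 + (h%:C)%C * il) = 1.
  rewrite /c mulVf//; apply/eqP => z0; move: normc_ge1.
  by rewrite z0 normc0 ler10.
have cn1 k : normc (c ^+ k) <= 1.
  elim: k => [|k IH]; first by rewrite expr0 normc1.
  by rewrite exprS normcM mulr_ile1// normc_ge0.
have telescope k :
    nrm (c ^+ k *: T (k%:R * h) u - u) <= k%:R * (M * nrm (c *: T h u - u)).
  elim: k => [|k IH].
    rewrite mul0r T0 expr0 scale1r subrr mul0r -(scale0r (0 : V)) nrmZ.
    by rewrite normc0 mul0r.
  have kh0 : 0 <= k%:R * h by rewrite mulr_ge0// ltW.
  rewrite -natr1 mulrDl mul1r (TD _ _ _ kh0 (ltW h0)).
  have TZ s a v : 0 <= s -> T s (a *: v - u) = a *: T s v - T s u.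
    move=> s0; have linT := (Tlin s s0).1.
    rewrite linT; congr (_ + _).
    have T00 : T s 0 = 0.
      have := linT (-1) 0 0; rewrite scaler0 addr0 scaleN1r.
      by move=> ->; rewrite addNr.
    by rewrite -scaleN1r -[X in T s X]addr0 linT T00 addr0 scaleN1r.
  rewrite (_ : _ - u = c ^+ k *: T (k%:R * h) (c *: T h u - u)
                       + (c ^+ k *: T (k%:R * h) u - u)); last first.
    by rewrite TZ// scalerBr scalerA -exprSr addrA subrK.
  rewrite mulrDl mul1r [leRHS]addrC (le_trans (nrmD _ _))// lerD//.
  rewrite nrmZ (le_trans _ (TleM _ _ kh0))// ler_piMl//.
have step : nrm (c *: T h u - u) <= h * (e + r).
  rewrite -[X in _ - X]scale1r -cK -scalerA -scalerBr nrmZ.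
  apply: (@le_trans _ _ (nrm (T h u - (1 + (h%:C)%C * il) *: u))).
    by rewrite ler_piMl.
  have hh : (h%:C)%C * (h^-1%:C)%C = 1.
    by rewrite -rmorphM/= divff ?gt_eqF.
  rewrite (_ : _ - _ = (h%:C)%C *: (((h^-1%:C)%C *: (T h u - u) - f) + (f - il *: u))).
    rewrite nrmZ /= expr0n addr0 sqrtr_sqr (ger0_norm (ltW h0)) (ler_wpM2l (ltW h0))//.
    apply: (le_trans (nrmD _ _)); rewrite lerD2r ltW//.
    have /= := dP h; rewrite sub0r normrN gtr0_norm// => /(_ nd h0).
    by rewrite sub0r normrN ger0_norm.
  rewrite addrA subrK scalerBr !scalerA hh scale1r scalerDl scale1r opprD addrA.
  by [].
have := telescope n.+1; rewrite hn => tel.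
have : nrm u <= nrm (c ^+ n.+1 *: T t u) + nrm (c ^+ n.+1 *: T t u - u).
  rewrite -[X in nrm X <= _](subKr (c ^+ n.+1 *: T t u)).
  by rewrite (le_trans (nrmD _ _))// nrmN.
move=> /le_trans; apply; apply: lerD.
  rewrite nrmZ (le_trans _ (le_trans (Tle _ u (ltW t0)) (ler_wpM2r _ Mt)))//.
  by rewrite ler_piMl.
apply: (le_trans tel); rewrite -hn -!mulrA ler_wpM2l//.
by rewrite [leRHS]mulrCA (ler_wpM2l (ltW M0)).
Qed.
End semigroup.

(** * Square-integrable functions and their classes *)

Section L2_representatives.
Context d (T : measurableType d) (R : realType).
Variables (mu : {measure set T -> \bar R}) (D : set T) (mD : measurable D).
Local Notation L2 := (L2 mu mD).
Implicit Types (u v : L2) (f g : T -> R[i]).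

Definition class_of f (fP : f \in L2pred mu mD) : L2 :=
  (\pi_L2 (MkL2fun fP))%qT.

Lemma L2rep_class f (fP : f \in L2pred mu mD) :
  L2rep (class_of fP) = f %[ae mu in D].
Proof.
have : (repr (class_of fP) - MkL2fun fP : L2fun mu mD) \in @L2null _ _ _ mu _ mD.
  by rewrite Quotient.idealrBE /class_of reprK.
move/L2nullP; apply: filterS => x /[apply] fx.
apply/eqP; rewrite -subr_eq0; apply/eqP; exact: fx.
Qed.

Lemma L2rep_sqint u : square_integrable mu D (L2rep u).
Proof. exact/L2predP/(valP (repr u)). Qed.

Lemma L2repD u v :
  L2rep (u + v) = (fun x => L2rep u x + L2rep v x) %[ae mu in D].
Proof.
have : (repr (u + v) - (repr u + repr v) : L2fun mu mD) \in @L2null _ _ _ mu _ mD.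
  by rewrite Quotient.idealrBE L2_piD !reprK.
move/L2nullP; apply: filterS => x /[apply] fx.
apply/eqP; rewrite -subr_eq0; apply/eqP; exact: fx.
Qed.

Lemma L2repZ (c : R[i]) u :
  L2rep (c *: u) = (fun x => c * L2rep u x) %[ae mu in D].
Proof.
have : (repr (c *: u) - (c *: repr u) : L2fun mu mD) \in @L2null _ _ _ mu _ mD.
  by rewrite Quotient.idealrBE -L2_piZ !reprK.
move/L2nullP; apply: filterS => x /[apply] fx.
apply/eqP; rewrite -subr_eq0; apply/eqP; exact: fx.
Qed.

Lemma Re_realM (a : R) (z : R[i]) :
  complex.Re ((a%:C)%C * z) = a * complex.Re z.
Proof. by case: z => x y; rewrite /= mul0r subr0. Qed.

Lemma Im_realM (a : R) (z : R[i]) :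
  complex.Im ((a%:C)%C * z) = a * complex.Im z.
Proof. by case: z => x y; rewrite /= mul0r addr0. Qed.

Lemma cintegral_weighted_ae (h : T -> R) f g : measurable_fun D h ->
  square_integrable mu D f -> square_integrable mu D g ->
  f = g %[ae mu in D] ->
  cintegral mu D (fun x => ((h x)%:C)%C * f x) =
  cintegral mu D (fun x => ((h x)%:C)%C * g x).
Proof.
move=> mh [fr fi _] [gr gi _] fg; rewrite /cintegral.
by congr (_ +i* _)%C; congr fine; apply: ae_eq_integral => //;
  first [apply: filterS fg => x /[apply] -> //
        |apply/measurable_EFinP; under eq_fun do rewrite Re_realM;
           exact: measurable_funM
        |apply/measurable_EFinP; under eq_fun do rewrite Im_realM;
           exact: measurable_funM].
Qed.

Lemma sqint_ae f g : square_integrable mu D f ->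
  measurable_fun D (fun x => complex.Re (g x)) ->
  measurable_fun D (fun x => complex.Im (g x)) ->
  f = g %[ae mu in D] -> square_integrable mu D g.
Proof.
move=> [fr fi /integrableP[mf foo]] gr gi fg; split=> //.
have mg : measurable_fun D (fun x => (normc (g x) ^+ 2 : R)%:E).
  by apply/measurable_EFinP; exact: measurable_normc2.
apply/integrableP; split=> //; apply: le_lt_trans foo.
rewrite le_eqVlt; apply/predU1P; left; apply: ae_eq_integral => //.
- exact: measurableT_comp.
- exact: measurableT_comp.
- by apply: filterS fg => x /[apply] ->.
Qed.

Lemma ae_eq_on f g h : f = g %[ae mu in D] -> (forall x, D x -> g x = h x) ->
  f = h %[ae mu in D].
Proof. by move=> fg gh; apply: filterS fg => x + Dx => ->//; exact: gh. Qed.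

Lemma L2rep_lin (c : R[i]) u v f g : L2rep u = f %[ae mu in D] ->
  L2rep v = g %[ae mu in D] ->
  L2rep (c *: u + v) = (fun x => c * f x + g x) %[ae mu in D].
Proof.
move=> uf vg; have Dcu := L2repD (c *: u) v; have Zu := L2repZ c u.
apply: filterS2 (filterI uf vg) (filterI Dcu Zu) => x [ux vx] [dx zx] Dx.
by rewrite (dx Dx) (zx Dx) (ux Dx) (vx Dx).
Qed.

Lemma L2rep0 : L2rep (0 : L2) = cst 0 %[ae mu in D].
Proof.
by have := L2repZ 0 (0 : L2); rewrite scaler0; apply: filterS => x + Dx => ->//;
  rewrite mul0r.
Qed.

Definition sqnorm f : R := \int[mu]_(x in D) (normc (f x) ^+ 2).

Lemma sqnorm_ge0 f : 0 <= sqnorm f.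
Proof. by apply: Rintegral_ge0 => x _; exact: sqr_ge0. Qed.

Lemma sqint_measurable f : square_integrable mu D f ->
  measurable_fun D (fun x => (normc (f x) ^+ 2 : R)%:E).
Proof. by case=> mr mi _; exact/measurable_EFinP/measurable_normc2. Qed.

Lemma sqnorm_ae f g : square_integrable mu D f -> square_integrable mu D g ->
  f = g %[ae mu in D] -> sqnorm f = sqnorm g.
Proof.
move=> /sqint_measurable mf /sqint_measurable mg fg; congr fine.
by apply: ae_eq_integral => //; apply: filterS fg => x /[apply] ->.
Qed.

Lemma integrable_mulr (h : T -> R) (c : R) : mu.-integrable D (EFin \o h) ->
  mu.-integrable D (EFin \o (fun x => c * h x)).
Proof.
move=> hi; rewrite (_ : _ \o _ = (fun x => c%:E * (EFin \o h) x)%E).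
  exact: integrableZl.
by apply/funext => x /=; rewrite EFinM.
Qed.

Lemma sqint_lin (c : R[i]) f g : square_integrable mu D f ->
  square_integrable mu D g -> square_integrable mu D (fun x => c * f x + g x).
Proof.
move=> /(L2predP mu mD) fP /(L2predP mu mD) gP; apply/(L2predP mu mD).
exact: ((L2pred_submod_closed mu mD).2 c f g fP gP).
Qed.

Lemma sqintZ (c : R[i]) f : square_integrable mu D f ->
  square_integrable mu D (fun x => c * f x).
Proof.
move=> fi; have /L2predP zi := (L2pred_submod_closed mu mD).1.
by have := sqint_lin c fi zi; under eq_fun do rewrite addr0.
Qed.

(** Optimizing over [e] recovers the triangle inequality, without any appeal to
    the Cauchy-Schwarz inequality. *)
Lemma sqnormD_le f g (e : R) : 0 < e -> square_integrable mu D f ->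
  square_integrable mu D g ->
  sqnorm (fun x => f x + g x) <= (1 + e) * sqnorm f + (1 + e^-1) * sqnorm g.
Proof.
move=> e0 fi gi; have := sqint_lin 1 fi gi.
under eq_fun do rewrite mul1r.
move: fi gi => [_ _ fi] [_ _ gi] [_ _ fgi].
rewrite -!RintegralZl// -RintegralD//; [|exact: integrable_mulr..].
apply: le_Rintegral => //.
  rewrite (_ : _ \o _ = ((EFin \o (fun x => (1 + e) * normc (f x) ^+ 2)%R) \+
                         (EFin \o (fun x => (1 + e^-1) * normc (g x) ^+ 2)%R))%E).
    by apply: integrableD => //; exact: integrable_mulr.
  by apply/funext => x /=; rewrite EFinD.
move=> x _; apply: (@le_trans _ _ ((normc (f x) + normc (g x)) ^+ 2)).
  by rewrite lerXn2r// ?nnegrE ?addr_ge0 ?Defs.normc_ge0 ?le_normcD.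
set a := normc (f x); set b := normc (g x).
rewrite -subr_ge0 (_ : _ - _ = e^-1 * (e * a - b) ^+ 2).
  by rewrite mulr_ge0 ?sqr_ge0// invr_ge0 ltW.
by field; rewrite gt_eqF.
Qed.

End L2_representatives.

(** * The energy norm *)

Section energy_norm.
Context (R : realType) (talpha rho : R).
Hypothesis talpha01 : 0 < talpha < 1.
Hypothesis rho_gt0 : 0 < rho.
Local Notation leb := (@lebesgue_measure R).
Local Notation H := (Hspace R).
Local Notation nrm := (Hnorm talpha rho).
Local Notation zeta := (zeta talpha rho).

Lemma zeta_gt0 : 0 < zeta.
Proof.
have /andP[t0 t1] := talpha01.
rewrite /Defs.zeta !mulr_gt0 ?invr_gt0 ?pi_gt0// sin_gt0_pi//.
by rewrite mulr_gt0 ?pi_gt0//= gtr_pMl ?pi_gt0.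
Qed.

Definition energy (u : H) : R :=
  sqnorm leb (@I01 R) (L2rep u.1) + zeta * sqnorm leb setT (L2rep u.2).

Lemma energy_ge0 u : 0 <= energy u.
Proof.
apply: addr_ge0; first exact: sqnorm_ge0.
by apply: mulr_ge0; [exact: ltW zeta_gt0|exact: sqnorm_ge0].
Qed.

Lemma HnormE u : nrm u = Num.sqrt (energy u).
Proof.
rewrite /Hnorm /Hinner /cintegral /energy /sqnorm; congr Num.sqrt.
simpc => /=; congr (_ + _ * _); apply: eq_Rintegral => x _;
  by rewrite normc2E; case: (L2rep _ x) => a b /=; rewrite mulrN opprK -!expr2.
Qed.

Lemma sqr_Hnorm u : nrm u ^+ 2 = energy u.
Proof. by rewrite HnormE sqr_sqrtr// energy_ge0. Qed.

Lemma Hnorm_ge0 u : 0 <= nrm u.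
Proof. by rewrite HnormE sqrtr_ge0. Qed.

Lemma HnormZ (c : R[i]) u : nrm (c *: u) = normc c * nrm u.
Proof.
rewrite !HnormE -[normc c]ger0_norm ?Defs.normc_ge0// -sqrtr_sqr.
rewrite -sqrtrM ?sqr_ge0//; congr Num.sqrt.
rewrite /energy mulrDr (mulrCA _ zeta).
have Z d (T : measurableType d) (mu : {measure set T -> \bar R}) (D : set T)
    (mD : measurable D) (v : L2 mu mD) :
    sqnorm mu D (L2rep (c *: v)) = normc c ^+ 2 * sqnorm mu D (L2rep v).
  have vi := L2rep_sqint v.
  rewrite (sqnorm_ae mD _ _ (L2repZ c v)); [|exact: L2rep_sqint|].
    rewrite -RintegralZl//; last by case: vi.
    by apply: eq_Rintegral => x _; rewrite normcM exprMn.
  exact: sqintZ.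
by congr (_ + _ * _); exact: Z.
Qed.

Lemma HnormD u v : nrm (u + v) <= nrm u + nrm v.
Proof.
have D d (T : measurableType d) (mu : {measure set T -> \bar R}) (D : set T)
    (mD : measurable D) (a b : L2 mu mD) (e : R) : 0 < e ->
    sqnorm mu D (L2rep (a + b)) <=
    (1 + e) * sqnorm mu D (L2rep a) + (1 + e^-1) * sqnorm mu D (L2rep b).
  move=> e0; have ai := L2rep_sqint a; have bi := L2rep_sqint b.
  rewrite (sqnorm_ae mD _ _ (L2repD a b)); [|exact: L2rep_sqint|].
    exact: sqnormD_le.
  by have := sqint_lin mD 1 ai bi; under eq_fun do rewrite mul1r.
have Q e : 0 < e ->
    energy (u + v) <= (1 + e) * energy u + (1 + e^-1) * energy v.
  move=> e0; rewrite /energy.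
  have := D _ _ _ _ _ u.1 v.1 e e0; have := D _ _ _ _ _ u.2 v.2 e e0.
  rewrite -(ler_pM2l zeta_gt0) => D2 D1.
  apply: (le_trans (lerD D1 D2)).
  by rewrite mulrDr (mulrCA zeta) (mulrCA zeta) !mulrDr addrACA.
apply/ler_addgt0Pr => e e0.
(* the shift keeps x and y positive, so that y / x can serve as the weight
   in the weighted triangle inequality Q *)
pose x := nrm u + e / 2; pose y := nrm v + e / 2.
have x0 : 0 < x by rewrite ltr_wpDl ?Hnorm_ge0// divr_gt0.
have y0 : 0 < y by rewrite ltr_wpDl ?Hnorm_ge0// divr_gt0.
have -> : nrm u + nrm v + e = x + y by rewrite /x /y; field.
have xy0 : 0 <= x + y by rewrite addr_ge0 ?(ltW x0) ?(ltW y0).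
rewrite HnormE -(ger0_norm xy0) -sqrtr_sqr ler_wsqrtr//.
have yx : 0 < y / x by rewrite divr_gt0.
apply: (le_trans (Q _ yx)).
have -> : (x + y) ^+ 2 = (1 + y / x) * x ^+ 2 + (1 + (y / x)^-1) * y ^+ 2.
  by field; rewrite !gt_eqF.
have le_sqr w r : nrm w <= r -> energy w <= r ^+ 2.
  move=> wr; rewrite -sqr_Hnorm lerXn2r// nnegrE ?Hnorm_ge0//.
  exact: le_trans (Hnorm_ge0 _) wr.
have e20 : 0 <= e / 2 by rewrite divr_ge0 ?(ltW e0).
apply: lerD; apply: ler_wpM2l.
- by rewrite addr_ge0 ?(ltW yx).
- by apply: le_sqr; rewrite lerDl.
- by rewrite addr_ge0 ?invr_ge0 ?(ltW yx).
- by apply: le_sqr; rewrite lerDl.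
Qed.

End energy_norm.

(** * A family of entire functions of Bessel type *)

Section entire_solution.
Context (R : realType).
Implicit Types (c : R^nat) (K M t x : R).

(** A coefficient bound that is stable under termwise differentiation and makes
    the power series converge everywhere. *)
Definition factorial_decay c := exists K M : R,
  [/\ 0 <= K, 0 <= M & forall n, `|c n| <= M * (K ^+ n / n`!%:R)].

Lemma factorial_decay_cvg c x : factorial_decay c -> cvgn (pseries c x).
Proof.
move=> [K [M [K0 M0 cKM]]]; apply: normed_cvg.
apply: (@series_le_cvg _ _ (fun n => M * exp_coeff (K * `|x|) n)).
- by move=> n; exact: normr_ge0.
- by move=> n; rewrite mulr_ge0// exp_coeff_ge0// mulr_ge0.
- move=> n /=; rewrite normrM normrX /exp_coeff /= exprMn.
  rewrite [leRHS](_ : _ = M * (K ^+ n / n`!%:R) * `|x| ^+ n); last by ring.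
  by rewrite ler_wpM2r// exprn_ge0.
- rewrite (_ : series _ = M *: series (exp_coeff (K * `|x|))).
    by apply: is_cvgZr; exact: is_cvg_series_exp_coeff.
  by apply/funext => n; rewrite /series /= -mulr_sumr.
Qed.

Lemma factorial_decay_diffs c :
  factorial_decay c -> factorial_decay (pseries_diffs c).
Proof.
move=> [K [M [K0 M0 cKM]]]; exists K, (M * K); split=> //; first exact: mulr_ge0.
move=> n; rewrite /pseries_diffs normrM ger0_norm//.
rewrite [leRHS](_ : _ = n.+1%:R * (M * (K ^+ n.+1 / n.+1`!%:R))).
  by rewrite ler_wpM2l.
have nf : n`!%:R != 0 :> R by rewrite pnatr_eq0 -lt0n fact_gt0.
have n0 : n.+1%:R != 0 :> R by rewrite pnatr_eq0.
by rewrite factS natrM exprS; field; rewrite nf nat1r n0.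
Qed.

Lemma factorial_decay_is_derive c x : factorial_decay c ->
  is_derive x 1 (fun x => limn (pseries c x)) (limn (pseries (pseries_diffs c) x)).
Proof.
move=> cd; have cd' := factorial_decay_diffs cd.
apply: (@pseries_snd_diffs _ _ (`|x| + 1)); do ?exact: factorial_decay_cvg.
  exact/factorial_decay_cvg/factorial_decay_diffs.
by rewrite [ltRHS]ger0_norm ?addr_ge0// ltrDl.
Qed.

Context (b s : R).
Hypotheses (b_gt0 : 0 < b) (s_gt0 : 0 < s).

(** With b = 2 - alpha, the values s = 1 and s = 1 - alpha + b give, in the
    variable y^b, the two solutions of (y^alpha h')' = - h at the origin, the
    second one up to a factor y^(1 - alpha). *)
Fixpoint bessel_coef (n : nat) : R := if n is m.+1
  then - bessel_coef m / (b * m.+1%:R * (s + b * m%:R)) else 1.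

Let denom_gt0 n : 0 < b * n.+1%:R * (s + b * n%:R).
Proof. by rewrite !mulr_gt0 ?ltr0n// ltr_wpDr// mulr_ge0// ltW. Qed.

Lemma bessel_coef_decay : factorial_decay bessel_coef.
Proof.
exists (b * s)^-1, 1; split=> //; first by rewrite invr_ge0 mulr_ge0// ltW.
elim=> [|n IH]; first by rewrite normr1 expr0 mul1r divr1.
rewrite mul1r in IH *; rewrite /= normrM normrN normfV (gtr0_norm (denom_gt0 n)).
rewrite ler_pdivrMr// (le_trans IH)// factS natrM exprS.
have nf : n`!%:R != 0 :> R by rewrite pnatr_eq0 -lt0n fact_gt0.
have n0 : n.+1%:R != 0 :> R by rewrite pnatr_eq0.
rewrite [leRHS](_ : _ = (b * s)^-1 ^+ n / n`!%:R * ((s + b * n%:R) / s)).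
  rewrite ler_peMr ?divr_ge0 ?exprn_ge0 ?invr_ge0 ?mulr_ge0 ?(ltW b_gt0) ?(ltW s_gt0)//.
  by rewrite ler_pdivlMr// mul1r lerDl mulr_ge0// ltW.
by field; rewrite nf nat1r n0 !gt_eqF.
Qed.

Definition bessel_fun x := limn (pseries bessel_coef x).
Definition bessel_fun' x := limn (pseries (pseries_diffs bessel_coef) x).
Definition bessel_fun'' x :=
  limn (pseries (pseries_diffs (pseries_diffs bessel_coef)) x).

Lemma is_derive_bessel x : is_derive x 1 bessel_fun (bessel_fun' x).
Proof. exact: factorial_decay_is_derive bessel_coef_decay. Qed.

Lemma is_derive_bessel' x : is_derive x 1 bessel_fun' (bessel_fun'' x).
Proof.
exact: factorial_decay_is_derive (factorial_decay_diffs bessel_coef_decay).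
Qed.

Lemma bessel_fun0 : bessel_fun 0 = 1.
Proof.
apply: cvg_lim => //; rewrite -(cvg_shiftn 1).
rewrite (_ : (fun n => _) = cst 1); first exact: cvg_cst.
apply/funext => n; rewrite /pseries /series /= addn1 big_nat_recl//= expr0 mulr1.
by rewrite big1 ?addr0// => i _; rewrite expr0n mulr0.
Qed.

(** The identity holds coefficient by coefficient; it is read off from the
    partial sums, where the series for the second derivative is shifted by one
    so as to absorb the factor [t]. *)
Lemma bessel_ode t :
  b ^+ 2 * t * bessel_fun'' t + b * s * bessel_fun' t + bessel_fun t = 0.
Proof.
set c := bessel_coef; have cd := bessel_coef_decay.
have dd := factorial_decay_diffs cd; have ddd := factorial_decay_diffs dd.
have c0 := @factorial_decay_cvg _ t cd.
have c1 := @factorial_decay_cvg _ t dd.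
have c2 := pseries_diffs_equiv (@factorial_decay_cvg _ t ddd).
have L := cvgD (cvgD (cvgM (cvg_cst (b ^+ 2 * t)) c2) (cvgM (cvg_cst (b * s)) c1)) c0.
rewrite -(cvg_lim _ (L _ _ _ _ _ _))//; apply: cvg_lim => //.
rewrite [X in X @ _ --> _](_ : _ = cst 0); first exact: cvg_cst.
apply/funext => n; rewrite [LHS](_ : _ =
    b ^+ 2 * t * (\sum_(0 <= k < n) k%:R * pseries_diffs c k * t ^+ k.-1) +
    b * s * (\sum_(0 <= k < n) pseries_diffs c k * t ^+ k) +
    \sum_(0 <= k < n) c k * t ^+ k)//.
rewrite !mulr_sumr -!big_split/= big1// => i _.
have -> : c i = - (b * i.+1%:R * (s + b * i%:R)) * c i.+1.
  by rewrite /c /= mulNr mulrC divfK ?opprK// gt_eqF.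
rewrite /pseries_diffs; case: i => [|i]; first by rewrite expr0; ring.
by rewrite [X in t ^+ X]/= (exprS t i); ring.
Qed.

End entire_solution.

(** * Solutions of the degenerate oscillator *)

Section abs_power.
Context (R : realType).
Implicit Types (s y : R).

Lemma is_derive_abs_powR s (y : R) : 0 < y ->
  is_derive y 1 (fun y => `|y| `^ s) (s * y `^ (s - 1)).
Proof.
move=> y0; apply: (@near_eq_is_derive _ _ _ (fun x => x `^ s)).
- near=> x; rewrite gtr0_norm//; near: x; exact: lt_nbhsr.
- exact: is_derive1_powR.
Unshelve. all: by end_near. Qed.

Lemma continuous_abs_powR s : 0 < s -> continuous (fun y : R => `|y| `^ s).
Proof.
move=> s0.
have pos (y : R) : 0 < y -> {for y, continuous (fun y : R => `|y| `^ s)}.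
  move=> y0; have [d _] := is_derive_abs_powR s y0.
  exact/differentiable_continuous/derivable1_diffP.
move=> y; have [y0|y0|<-] := ltgtP 0 y.
- exact: pos.
- have -> : (fun y : R => `|y| `^ s) = (fun y => `|y| `^ s) \o -%R.
    by apply/funext => x /=; rewrite normrN.
  apply: continuous_comp; first exact: opp_continuous.
  by apply: pos; rewrite oppr_gt0.
- suff H : `|x| `^ s @[x --> (0 : R)] --> (0 : R).
    by rewrite /continuous_at normr0 powR0 ?gt_eqF.
  apply/cvgrPdist_lt => e e0; near=> x.
  rewrite sub0r normrN ger0_norm ?powR_ge0//.
  have <- : (e `^ s^-1) `^ s = e by rewrite -powRrM mulVf ?gt_eqF// powRr1// ltW.
  rewrite gt0_ltr_powR ?nnegrE ?powR_ge0//.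
  near: x; exact: (@nbhs0_lt _ R _ (powR_gt0 _ e0)).
Unshelve. all: by end_near. Qed.

End abs_power.

Section degenerate_solutions.
Context (R : realType) (alpha : R).
Hypotheses (alpha_gt0 : 0 < alpha) (alpha_lt1 : alpha < 1).
Local Notation beta := (2 - alpha).

(** The equation (y^alpha h')' = - h as a first-order system; the flux
    [k] = y^alpha h' stays continuous at the degenerate point 0, where h' may
    blow up. *)
Definition flux_pair (h k : R -> R) := [/\ continuous h, continuous k,
  forall y : R, 0 < y -> is_derive y 1 h (k y / y `^ alpha) &
  forall y : R, 0 < y -> is_derive y 1 k (- h y)].

Let bg : 0 < beta. Proof. by move: alpha_lt1; lra. Qed.
Let tp (y : R) := `|y| `^ beta.

Let tpE (y : R) : 0 < y -> tp y = y * (y / y `^ alpha).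
Proof.
move=> y0; rewrite /tp (gtr0_norm y0) powRB ?(gt_eqF y0) ?implybT//.
by rewrite powR_mulrn ?(ltW y0)// expr2 mulrA.
Qed.

Let is_derive_tp (y : R) : 0 < y -> is_derive y 1 tp (beta * (y / y `^ alpha)).
Proof.
move=> y0; have := is_derive_abs_powR beta y0.
rewrite (_ : beta - 1 = 1 - alpha); last by ring.
by rewrite powRB ?(gt_eqF y0) ?implybT// powRr1 ?(ltW y0).
Qed.

Let continuous_tp : continuous tp.
Proof. exact: continuous_abs_powR. Qed.

Let is_derive_continuous (h dh : R -> R) :
  (forall x : R, is_derive x 1 h (dh x)) -> continuous h.
Proof.
by move=> hd x; apply/differentiable_continuous/derivable1_diffP; case: (hd x).
Qed.

Let comp_tp (h dh : R -> R) : (forall x : R, is_derive x 1 h (dh x)) ->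
  forall y : R, 0 < y ->
  is_derive y 1 (h \o tp) (dh (tp y) * (beta * (y / y `^ alpha))).
Proof. by move=> hd y y0; apply: is_derive1_comp; exact: is_derive_tp. Qed.

Let continuous_comp_tp (h : R -> R) : continuous h -> continuous (h \o tp).
Proof.
by move=> hc y; apply: continuous_comp; [exact: continuous_tp|exact: hc].
Qed.

(** The factorization of the flux by [y] is what makes the energy
    F^2 + p^2 / y^alpha tend to 1 at the origin. *)
Lemma regular_solution : exists F p P : R -> R,
  [/\ flux_pair F p, continuous P, forall y, p y = y * P y & F 0 = 1].
Proof.
have d0 := is_derive_bessel bg (@ltr01 R).
have d1 := is_derive_bessel' bg (@ltr01 R).
have ode := bessel_ode bg (@ltr01 R).
set f := bessel_fun _ _ in d0 ode; set f' := bessel_fun' _ _ in d0 d1 ode.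
set f'' := bessel_fun'' _ _ in d1 ode.
have cf := is_derive_continuous d0; have cf' := is_derive_continuous d1.
exists (f \o tp), (fun y => y * (beta * f' (tp y))), (fun y => beta * f' (tp y)).
have cP : continuous (fun y => beta * f' (tp y)).
  move=> y; apply: cvgM; first exact: cvg_cst.
  exact: (continuous_comp_tp cf').
split; [|exact: cP|by []|]; last first.
  by rewrite /tp /= normr0 powR0 ?gt_eqF// /f bessel_fun0.
split.
- exact: continuous_comp_tp.
- by move=> y; apply: cvgM; [exact: cvg_id|exact: cP].
- move=> y y0; apply: (is_derive_eq (comp_tp d0 y0)).
  by field; rewrite gt_eqF ?powR_gt0.
- move=> y y0; have Y := comp_tp d1 y0.
  apply: (@is_derive_eq _ _ _ (@idfun R * (cst beta * (f' \o tp)))).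
  have := ode (tp y); rewrite mulr1 /= => /eqP; rewrite addr_eq0 => /eqP <-.
  rewrite /GRing.scale /= /cst /= ?mulrfctE /= (tpE y0); field.
  by rewrite gt_eqF ?powR_gt0.
Qed.

Lemma singular_solution : exists G q : R -> R,
  [/\ flux_pair G q, G 0 = 0 & q 0 = 1].
Proof.
have s0 : 0 < 1 - alpha + beta by move: alpha_lt1; lra.
have d0 := is_derive_bessel bg s0.
have d1 := is_derive_bessel' bg s0.
have ode := bessel_ode bg s0.
set f := bessel_fun _ _ in d0 ode; set f' := bessel_fun' _ _ in d0 d1 ode.
set f'' := bessel_fun'' _ _ in d1 ode.
have cf := is_derive_continuous d0; have cf' := is_derive_continuous d1.
have a10 : 1 - alpha != 0 by rewrite subr_eq0 gt_eqF.
pose u (y : R) := `|y| `^ (1 - alpha).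
have cu : continuous u by apply: continuous_abs_powR; rewrite subr_gt0.
have du (y : R) : 0 < y -> is_derive y 1 u ((1 - alpha) / y `^ alpha).
  move=> y0; have := is_derive_abs_powR (1 - alpha) y0.
  by rewrite (_ : 1 - alpha - 1 = - alpha) ?powRN//; ring.
have uE (y : R) : 0 < y -> u y = y / y `^ alpha.
  by move=> y0; rewrite /u gtr0_norm// powRB ?(gt_eqF y0) ?implybT// powRr1 ?(ltW y0).
have t0 : tp 0 = 0 by rewrite /tp normr0 powR0 ?gt_eqF.
exists (fun y => (1 - alpha)^-1 * (u y * f (tp y))),
  (fun y => f (tp y) + beta / (1 - alpha) * (tp y * f' (tp y))).
split; last 2 first.
- by rewrite /u normr0 powR0 ?mul0r ?mulr0// subr_eq0 gt_eqF.
- by rewrite t0 mul0r mulr0 addr0 /f bessel_fun0.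
split.
- move=> y; apply: cvgM; first exact: cvg_cst.
  by apply: cvgM; [exact: cu|exact: (continuous_comp_tp cf)].
- move=> y; apply: cvgD; first exact: (continuous_comp_tp cf).
  apply: cvgM; first exact: cvg_cst.
  by apply: cvgM; [exact: continuous_tp|exact: (continuous_comp_tp cf')].
- move=> y y0; have Y0 := comp_tp d0 y0; have U := du y y0.
  apply: is_derive_eq (is_deriveM (is_derive_cst (1 - alpha)^-1 y 1)
    (is_deriveM U Y0)) _.
  rewrite /GRing.scale /= /cst /= ?mulrfctE /= (tpE y0) (uE _ y0); field.
  by rewrite a10 gt_eqF ?powR_gt0.
- move=> y y0; have Y0 := comp_tp d0 y0; have Y1 := comp_tp d1 y0.
  have T := is_derive_tp y0.
  apply: is_derive_eq (is_deriveD Y0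
    (is_deriveM (is_derive_cst (beta / (1 - alpha)) y 1) (is_deriveM T Y1))) _.
  have := ode (tp y); rewrite /= => /eqP; rewrite addrC addr_eq0 => /eqP ->.
  rewrite /GRing.scale /= /cst /= ?mulrfctE /= (tpE y0) (uE _ y0); field.
  by rewrite a10 gt_eqF ?powR_gt0.
Qed.

End degenerate_solutions.

(** * Energy, Wronskian and oscillation *)

Section mean_value.
Context (R : realType).

Lemma ndecr_of_derive_ge0 (h dh : R -> R) (a b : R) : a <= b ->
  {within `[a, b], continuous h} ->
  (forall y : R, a < y < b -> is_derive y 1 h (dh y)) ->
  (forall y : R, a < y < b -> 0 <= dh y) -> h a <= h b.
Proof.
rewrite le_eqVlt => /predU1P[->//|ab] hc hd dh0.
have hd' y : y \in `]a, b[ -> is_derive y 1 h (dh y) by rewrite in_itv; exact: hd.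
have [c + hab] := MVT ab hd' hc; rewrite in_itv/= => cab.
by rewrite -subr_ge0 hab mulr_ge0 ?dh0// subr_ge0 ltW.
Qed.

Lemma ndecr_pos (h dh : R -> R) (a b : R) : 0 < a -> a <= b ->
  (forall y : R, 0 < y -> is_derive y 1 h (dh y)) ->
  (forall y : R, a <= y -> 0 <= dh y) -> h a <= h b.
Proof.
move=> a0 ab hd dh0; apply: (@ndecr_of_derive_ge0 h dh) => //.
- apply: derivable_within_continuous => y; rewrite in_itv/= => /andP[ay _].
  by have [] := hd y (lt_le_trans a0 ay).
- by move=> y /andP[ay _]; apply: hd; exact: lt_trans ay.
- by move=> y /andP[ay _]; rewrite dh0// ltW.
Qed.

End mean_value.

Section flux_pairs.
Context (R : realType) (alpha : R).
Hypotheses (alpha_gt0 : 0 < alpha) (alpha_lt1 : alpha < 1).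
Local Notation beta := (2 - alpha).
Local Notation flux_pair := (flux_pair alpha).

Lemma is_derive_powR' (s : R) (y : R) : 0 < y ->
  is_derive y 1 (fun y : R => y `^ s) (s * y `^ s / y).
Proof.
move=> y0; apply: (is_derive_eq (is_derive1_powR s y0)).
by rewrite powRB ?(gt_eqF y0) ?implybT// powRr1 ?(ltW y0)// mulrA.
Qed.

Lemma flux_pairN h k : flux_pair h k -> flux_pair (- h) (- k).
Proof.
move=> [hc kc dh dk]; split.
- by move=> y; exact: cvgN (hc y).
- by move=> y; exact: cvgN (kc y).
- move=> y y0; have ? := dh y y0; apply: is_derive_eq.
  by rewrite mulNr.
- by move=> y y0; have ? := dk y y0; apply: is_derive_eq.
Qed.

(** The derivative of the energy is - alpha k^2 / y^(alpha + 1). *)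
Lemma energy_nincr h k (a b : R) : flux_pair h k -> 0 < a -> a <= b ->
  h b ^+ 2 + k b ^+ 2 / b `^ alpha <= h a ^+ 2 + k a ^+ 2 / a `^ alpha.
Proof.
move=> [_ _ dh dk] a0 ab.
rewrite -lerN2 -!powRN.
apply: (@ndecr_pos _ (fun y => - (h y ^+ 2 + k y ^+ 2 * y `^ (- alpha)))
  (fun y => alpha * k y ^+ 2 * y `^ (- alpha) / y)) => //= y => [y0|ay].
- have Y := dh y y0; have Z := dk y y0; have W := is_derive_powR' (- alpha) y0.
  apply: is_derive_eq (is_deriveN (is_deriveD (is_deriveM Y Y)
    (is_deriveM (is_deriveM Z Z) W))) _.
  rewrite /GRing.scale /= ?mulrfctE !powRN; field.
  by rewrite !gt_eqF ?powR_gt0.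
- have y0 := lt_le_trans a0 ay.
  apply: divr_ge0 (ltW y0); apply: mulr_ge0 (powR_ge0 _ _).
  exact: mulr_ge0 (ltW alpha_gt0) (sqr_ge0 _).
Qed.

Lemma wronskian F p G q : flux_pair F p -> flux_pair G q ->
  forall y, 0 <= y -> F y * q y - p y * G y = F 0 * q 0 - p 0 * G 0.
Proof.
move=> [Fc pc dF dp] [Gc qc dG dq] y y0.
have cW : continuous (F * q - p * G).
  by move=> x; apply: cvgB; apply: cvgM; [exact: Fc|exact: qc|exact: pc|exact: Gc].
have dW (x : R) : 0 < x -> is_derive x 1 (F * q - p * G) 0.
  move=> x0; apply: is_derive_eq (is_deriveB
    (is_deriveM (dF x x0) (dq x x0)) (is_deriveM (dp x x0) (dG x x0))) _.
  by rewrite /GRing.scale /=; field; rewrite gt_eqF ?powR_gt0.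
apply: le_anti; apply/andP; split.
  rewrite -lerN2.
  apply: (@ndecr_of_derive_ge0 _ (- (F * q - p * G)) (fun=> - 0) _ _ y0).
  - by apply: continuous_subspaceT => x; apply: cvgN; exact: cW.
  - by move=> x /andP[x0 _]; have := dW x x0 => ?; apply: is_deriveN.
  - by move=> x _; rewrite oppr0.
apply: (@ndecr_of_derive_ge0 _ (F * q - p * G) (fun=> 0) _ _ y0); last by [].
- exact: continuous_subspaceT.
- by move=> x /andP[x0 _]; exact: dW.
Qed.

(** With a positive flux h is increasing.  If h becomes positive, then k
    decreases at least linearly and changes sign.  If h stays nonpositive, then k
    is nondecreasing, so h grows at least like y^(1 - alpha), which is unbounded:
    a contradiction either way. *)
Lemma no_positive_flux h k (B : R) : flux_pair h k -> 0 < B ->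
  ~ (forall y, B <= y -> 0 < k y).
Proof.
move=> hk; have [hc kc dh dk] := hk => B0 kpos.
have kmono a b : B <= a -> a <= b -> (forall y, a <= y -> h y <= 0) -> k a <= k b.
  move=> Ba ab h0; apply: (@ndecr_pos _ k (fun y => - h y)) => //.
  - exact: lt_le_trans Ba.
  - by move=> y /h0; rewrite oppr_ge0.
have hmono a b : B <= a -> a <= b -> h a <= h b.
  move=> Ba ab; apply: (@ndecr_of_derive_ge0 _ h (fun y => k y / y `^ alpha)) => //.
  - exact: continuous_subspaceT.
  - move=> y /andP[ay _]; apply: dh.
    exact: lt_trans (lt_le_trans B0 Ba) ay.
  - move=> y /andP[ay _]; rewrite divr_ge0 ?powR_ge0// ltW// kpos//.
    by rewrite (le_trans Ba)// ltW.
have [[y1 By1 hy1]|h0] := pselect (exists2 y, B <= y & 0 < h y).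
  have y10 := lt_le_trans B0 By1.
  (* at this point the linear upper bound on k from y1 reaches 0 *)
  pose y2 := y1 + k y1 / h y1.
  have y12 : y1 <= y2 by rewrite lerDl divr_ge0 ?ltW ?kpos.
  have : k y2 + h y1 * y2 <= k y1 + h y1 * y1.
    rewrite -lerN2.
    apply: (@ndecr_of_derive_ge0 _ (- (k + cst (h y1) * id))
      (fun y => h y - h y1) _ _ y12).
    - apply: continuous_subspaceT => x; apply: cvgN; apply: cvgD; first exact: kc.
      by apply: cvgM; [exact: cvg_cst|exact: cvg_id].
    - move=> y /andP[ay _]; have D := dk y (lt_trans y10 ay).
      apply: is_derive_eq (is_deriveN (is_deriveD D
        (is_deriveM (is_derive_cst (h y1) y 1) (is_derive_id y 1)))) _.
      by rewrite /GRing.scale /= /cst; ring.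
    - by move=> y /andP[ay _]; rewrite subr_ge0 hmono// ltW.
  rewrite /y2 mulrDr mulrCA divff ?gt_eqF// mulr1 => H.
  have := kpos y2 (le_trans By1 y12); rewrite /y2; move: H; set k2 := k _; lra.
have {}h0 y : B <= y -> h y <= 0.
  by move=> By; rewrite leNgt; apply/negP => hy; apply: h0; exists y.
have kB y : B <= y -> k B <= k y.
  by move=> By; apply: kmono => //.
pose c := k B / (1 - alpha).
have a1 : 0 < 1 - alpha by rewrite subr_gt0.
have c0 : 0 < c by rewrite divr_gt0// kpos.
(* at this point the lower bound on h from B reaches 1 *)
pose y2 := ((1 - h B) / c + B `^ (1 - alpha)) `^ (1 - alpha)^-1.
have hB1 : 0 < 1 - h B by rewrite subr_gt0 (le_lt_trans (h0 _ _)).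
have y2E : y2 `^ (1 - alpha) = (1 - h B) / c + B `^ (1 - alpha).
  rewrite /y2 -powRrM mulVf ?gt_eqF// powRr1// addr_ge0 ?powR_ge0//.
  by rewrite divr_ge0 ?ltW.
have By2 : B <= y2.
  have y20 : 0 <= y2 by rewrite powR_ge0.
  rewrite leNgt; apply/negP => /(gt0_ltr_powR a1).
  rewrite !nnegrE y20 (ltW B0) => /(_ isT isT).
  by rewrite y2E gtrDr ltNge ltW// divr_gt0.
have : h B - c * B `^ (1 - alpha) <= h y2 - c * y2 `^ (1 - alpha).
  apply: (@ndecr_of_derive_ge0 _ (h - cst c * (fun y => y `^ (1 - alpha)))
    (fun y => (k y - k B) / y `^ alpha)) => //.
  - apply: derivable_within_continuous => y; rewrite in_itv/= => /andP[ay _].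
    have y0 := lt_le_trans B0 ay.
    have Y := dh y y0; have Z := is_derive_powR' (1 - alpha) y0.
    by apply: ex_derive.
  - move=> y /andP[ay _]; have y0 := lt_trans B0 ay.
    have Y := dh y y0; have Z := is_derive_powR' (1 - alpha) y0.
    apply: is_derive_eq; rewrite /GRing.scale /= /cst /c.
    rewrite powRB ?(gt_eqF y0) ?implybT// powRr1 ?(ltW y0)//.
    by field; rewrite !gt_eqF ?powR_gt0.
  - by move=> y /andP[ay _]; rewrite divr_ge0 ?powR_ge0// subr_ge0 kB// ltW.
rewrite y2E mulrDr mulrCA divff ?gt_eqF// mulr1.
have := h0 _ By2; lra.
Qed.

Lemma flux_zero h k (B : R) : flux_pair h k -> exists2 y, B <= y & k y = 0.
Proof.
move=> hk; pose B1 := Num.max B 1.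
have B10 : 0 < B1 by rewrite lt_max ltr01 orbT.
have BB1 : B <= B1 by rewrite le_max lexx.
have [_ kc _ _] := hk.
have [[y1 By1 ky1]|kp] := pselect (exists2 y, B1 <= y & k y <= 0); last first.
  exfalso; apply: (no_positive_flux hk B10) => y By.
  by rewrite ltNge; apply/negP => ky; apply: kp; exists y.
have [[y2 By2 ky2]|kn] := pselect (exists2 y, B1 <= y & 0 <= k y); last first.
  exfalso; apply: (no_positive_flux (flux_pairN hk) B10) => y By.
  rewrite ltNge; apply/negP => ky; apply: kn; exists y => //.
  by rewrite -oppr_le0.
have [y12|y21] := leP y1 y2.
  have [|y] := @IVT _ k y1 y2 0 y12 (continuous_subspaceT kc).
    by rewrite ge_min le_max ky1 ky2 orbT.
  rewrite in_itv/= => /andP[y1y _] ky; exists y => //.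
  by rewrite (le_trans BB1)// (le_trans By1).
have [|y] := @IVT _ k y2 y1 0 (ltW y21) (continuous_subspaceT kc).
  by rewrite ge_min le_max ky1 ky2 orbT.
rewrite in_itv/= => /andP[y1y _] ky; exists y => //.
by rewrite (le_trans BB1)// (le_trans By2).
Qed.

End flux_pairs.

(** * Decay rate of the oscillations *)

Section amplitude.
Context (R : realType) (alpha : R).
Hypotheses (alpha_gt0 : 0 < alpha) (alpha_lt1 : alpha < 1).
Local Notation beta := (2 - alpha).
Local Notation flux_pair := (flux_pair alpha).

(** The rate y^(alpha / 2) is the one of the WKB amplitude.  The derivative of
    y^(alpha / 2) (h^2 + k^2 / y^alpha) has no sign, but up to lower order it is
    the derivative of - (alpha / 2) y^(alpha / 2 - 1) k h.  Correcting by this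
    term leaves a multiple of y^(alpha / 2 - 2) k h, which is corrected once more
    using (k^2)' = - 2 k h.  The resulting [Z] has a nonnegative derivative, and
    both corrections vanish together with the flux. *)
Lemma amplitude_lower_bound h k : flux_pair h k -> (h 1, k 1) != (0, 0) ->
  exists2 c : R, 0 < c & forall r : R, 1 <= r -> k r = 0 ->
    c <= r `^ (alpha / 2) * h r ^+ 2.
Proof.
move=> [_ _ dh dk] hk1.
pose e := alpha / 2; pose c0 := e * (1 - e) / 2.
pose m (s y : R) := y `^ s.
pose Z := m e * (h * h) + cst e * (m (e - 1) * (k * h)) + m (- e) * (k * k)
  - cst c0 * (m (e - 2) * (k * k)).
have mE y : 0 < y -> [/\ y `^ alpha = m e y * m e y, m (e - 1) y = m e y / y,
    m (- e) y = (m e y)^-1 & m (e - 2) y = m e y / y ^+ 2].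
  move=> y0; rewrite /m; split.
  - by rewrite -powRD ?(gt_eqF y0) ?implybT//; congr (_ `^ _); rewrite /e; field.
  - by rewrite powRB ?(gt_eqF y0) ?implybT// powRr1 ?(ltW y0).
  - by rewrite powRN.
  - by rewrite powRB ?(gt_eqF y0) ?implybT// powR_mulrn ?(ltW y0).
(* at y = 1 the form Z is positive definite in h 1 and k 1 *)
exists (Z 1).
  rewrite (_ : Z 1 = (h 1 + e / 2 * k 1) ^+ 2
      + ((1 - alpha / 8) ^+ 2 + 3 * alpha ^+ 2 / 64) * k 1 ^+ 2); last first.
    by rewrite /Z /m !(addrfctE, mulrfctE, opprfctE) /cst !powR1 /c0 /e; field.
  have kc : 0 < (1 - alpha / 8) ^+ 2 + 3 * alpha ^+ 2 / 64.
    by rewrite ltr_wpDl ?sqr_ge0// !mulr_gt0.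
  have [k0|k0] := eqVneq (k 1) 0.
    rewrite k0 !(mulr0, expr0n, addr0) exprn_even_gt0//=.
    by apply: contra hk1 => /eqP ->; rewrite k0.
  rewrite ltr_wpDl ?sqr_ge0// mulr_gt0//.
  by rewrite exprn_even_gt0.
move=> r r1 kr.
have -> : r `^ (alpha / 2) * h r ^+ 2 = Z r.
  by rewrite /Z !(addrfctE, mulrfctE, opprfctE) /cst kr /m -/e; ring.
apply: (@ndecr_pos _ Z (fun y => c0 * (2 - e) * m e y * k y ^+ 2 / y ^+ 3) _ _
  ltr01 r1).
- move=> y y0; have Y1 := dh y y0; have Y2 := dk y y0.
  have D s : is_derive y 1 (m s) (s * m s y / y) := is_derive_powR' s y0.
  have D1 := D e; have D2 := D (e - 1); have D3 := D (- e); have D4 := D (e - 2).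
  have hh := is_deriveM Y1 Y1; have kh := is_deriveM Y2 Y1.
  have kk := is_deriveM Y2 Y2.
  have Z1 := is_deriveD (is_deriveM D1 hh)
    (is_deriveM (is_derive_cst e y 1) (is_deriveM D2 kh)).
  apply: is_derive_eq (is_deriveB (is_deriveD Z1 (is_deriveM D3 kk))
    (is_deriveM (is_derive_cst c0 y 1) (is_deriveM D4 kk))) _.
  rewrite /GRing.scale /= /cst /= ?mulrfctE.
  have [E1 E2 E3 E4] := mE y y0; rewrite E1 E2 E3 E4 /c0 /e; field.
  by rewrite !gt_eqF ?powR_gt0.
- move=> y y1; have y0 := lt_le_trans ltr01 y1.
  have e0 : 0 <= e by rewrite divr_ge0// ltW.
  have c00 : 0 <= c0 by rewrite /c0 /e; move: alpha_gt0 alpha_lt1; nra.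
  have e2 : 0 <= 2 - e by rewrite /e; move: alpha_lt1; lra.
  apply: divr_ge0 (exprn_ge0 _ (ltW y0)); apply: mulr_ge0 (sqr_ge0 _).
  by apply: mulr_ge0 (powR_ge0 _ _); apply: mulr_ge0.
Qed.

End amplitude.

(** * Corrected modes on the unit interval *)

Section quasimodes.
Context (R : realType) (alpha : R).
Hypotheses (alpha_gt0 : 0 < alpha) (alpha_lt1 : alpha < 1).
Local Notation beta := (2 - alpha).
Local Notation leb := (@lebesgue_measure R).

Lemma bounded_solution h k : flux_pair alpha h k ->
  exists C : R, forall y, 0 <= y -> `|h y| <= C.
Proof.
move=> hk; have [hc _ _ _] := hk.
have nc : {within `[0, 1], continuous (fun y => `|h y|)}.
  by apply: continuous_subspaceT => y; apply: cvg_norm; exact: hc.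
have [c /= _ hmax] := EVT_max ler01 nc.
pose E1 := h 1 ^+ 2 + k 1 ^+ 2 / 1 `^ alpha.
exists (Num.max `|h c| (Num.sqrt E1)) => y y0.
rewrite le_max; have [y1|y1] := leP y 1.
  by rewrite hmax// in_itv/= y0.
apply/orP; right; rewrite -sqrtr_sqr ler_wsqrtr//.
have := energy_nincr alpha_gt0 hk ltr01 (ltW y1).
by apply: le_trans; rewrite lerDl divr_ge0 ?sqr_ge0 ?powR_ge0.
Qed.

(** The energy is nonincreasing, and its limit at 0 is F(0)^2 = 1. *)
Lemma regular_energy_le1 F p P : flux_pair alpha F p -> continuous P ->
  (forall y, p y = y * P y) -> F 0 = 1 ->
  forall y, 0 < y -> F y ^+ 2 + p y ^+ 2 / y `^ alpha <= 1.
Proof.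
move=> Fp Pc pE F0 y y0; have [Fc _ _ _] := Fp.
pose E x := F x * F x + `|x| `^ beta * (P x * P x).
have b0 : 0 < beta by move: alpha_lt1; lra.
have EE x : 0 < x -> E x = F x ^+ 2 + p x ^+ 2 / x `^ alpha.
  move=> x0; rewrite /E pE gtr0_norm// powRB ?(gt_eqF x0) ?implybT//.
  by rewrite powR_mulrn ?(ltW x0)//; field; rewrite gt_eqF ?powR_gt0.
have Ec : continuous E.
  move=> x; apply: cvgD; first by apply: cvgM; exact: Fc.
  apply: cvgM; first exact: continuous_abs_powR.
  by apply: cvgM; exact: Pc.
have E0 : E 0 = 1 by rewrite /E normr0 powR0 ?gt_eqF// F0 mul0r addr0 mulr1.
rewrite -EE// -E0.
have Ey : E x @[x --> 0^'+] --> E 0 by apply: cvg_at_right_filter; exact: Ec.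
apply: (cvgr_to_ge Ey); near=> x.
have x0 : 0 < x by near: x; exact: nbhs_right_gt.
have xy : x < y by near: x; exact: nbhs_right_lt.
by rewrite !EE//; apply: (energy_nincr alpha_gt0 Fp) => //; exact: ltW.
Unshelve. all: by end_near. Qed.

(** A solution [v] of (x^alpha v')' = f together with its flux [g]. *)
Definition flux_ode (f v g : R -> R) := [/\ continuous v, continuous g,
  forall x : R, 0 < x -> is_derive x 1 v (g x / x `^ alpha) &
  forall x : R, 0 < x -> is_derive x 1 g (f x)].

(** y F^2 + y^(1 - alpha) p^2 - (1 - alpha) p F is a primitive of beta F^2, and
    only its first term survives where the flux vanishes. *)
Lemma integral_sqr_regular F p (r : R) : flux_pair alpha F p -> F 0 = 1 ->
  p 0 = 0 -> 0 < r -> p r = 0 ->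
  (\int[leb]_(x in `[0%R, 1%R]) (F (r * x) ^+ 2)%:E = (F r ^+ 2 / beta)%:E)%E.
Proof.
move=> [Fc pc dF dp] F0 p0 r0 pr.
have b0 : beta != 0 by rewrite gt_eqF//; move: alpha_lt1; lra.
pose u (y : R) := `|y| `^ (1 - alpha).
have cu : continuous u by apply: continuous_abs_powR; rewrite subr_gt0.
pose J y := y * (F y * F y) + u y * (p y * p y) - (1 - alpha) * (p y * F y).
have cJ : continuous J.
  move=> y; apply: cvgB; last first.
    by apply: cvgM; [exact: cvg_cst|apply: cvgM; [exact: pc|exact: Fc]].
  apply: cvgD; apply: cvgM; [exact: cvg_id| |exact: cu|]; apply: cvgM;
    [exact: Fc|exact: Fc|exact: pc|exact: pc].
have dJ (y : R) : 0 < y -> is_derive y 1 J (beta * F y ^+ 2).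
  move=> y0; have D1 := dF y y0; have D2 := dp y y0.
  have D3 : is_derive y 1 u ((1 - alpha) / y `^ alpha).
    have := is_derive_abs_powR (1 - alpha) y0.
    by rewrite (_ : 1 - alpha - 1 = - alpha) ?powRN//; ring.
  have D4 := is_deriveD (is_deriveM (is_derive_id y 1) (is_deriveM D1 D1))
    (is_deriveM D3 (is_deriveM D2 D2)).
  apply: is_derive_eq (is_deriveB D4
    (is_deriveM (is_derive_cst (1 - alpha) y 1) (is_deriveM D2 D1))) _.
  have uE : u y = y / y `^ alpha.
    by rewrite /u gtr0_norm// powRB ?(gt_eqF y0) ?implybT// powRr1 ?(ltW y0).
  rewrite /GRing.scale /= /cst /= ?mulrfctE uE; field.
  by rewrite gt_eqF ?powR_gt0.
pose H x := (r * beta)^-1 * J (r * x).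
have cr : continuous (fun x => r * x : R).
  by move=> x; apply: cvgM; [exact: cvg_cst|exact: cvg_id].
have cH : continuous H.
  move=> x; apply: cvgM; first exact: cvg_cst.
  by apply: (@continuous_comp _ _ _ ( *%R r) J); [exact: cr|exact: cJ].
have dH (x : R) : 0 < x -> is_derive x 1 H (F (r * x) ^+ 2).
  move=> x0; have D1 := dJ (r * x) (mulr_gt0 r0 x0).
  have D2 : is_derive x 1 (fun x : R => r * x) r.
    apply: (@is_derive_eq _ _ _ (cst r * id)).
    by rewrite /GRing.scale /= /cst mulr1 mulr0 addr0.
  have D3 := is_derive1_comp D1 D2.
  apply: (@is_derive_eq _ _ _ (cst (r * beta)^-1 * (J \o (fun x : R => r * x)))).
  by rewrite /GRing.scale /= /cst mulr0 addr0; field; rewrite b0 gt_eqF.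
rewrite (@continuous_FTC2 _ _ H) ?ltr01//.
- rewrite -EFinB /H /J mulr1 mulr0 /u normr0 powR0 ?subr_eq0 ?gt_eqF// pr p0.
  by congr EFin; field; rewrite b0 gt_eqF.
- apply: continuous_subspaceT => x; apply: (@continuous_comp _ _ _ ( *%R r)
    (fun y => F y ^+ 2)); [exact: cr|].
  by apply: cvgM; exact: Fc.
- split.
  + by move=> x; rewrite in_itv/= => /andP[x0 _]; have [] := dH x x0.
  + by apply: cvg_at_right_filter; exact: cH.
  + by apply: cvg_at_left_filter; exact: cH.
- move=> x; rewrite in_itv/= => /andP[x0 _].
  by rewrite derive1E; have [_ ->] := dH x x0.
Qed.

(** [v] is the mode F(r x) with flux [g], and [w] the corrector, of flux [k].
    The forcing term of the corrector is a multiple of the mode itself: this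
    makes its norm as small as the compatibility condition at the two ends
    allows. *)
Record corrected_mode (c C r D : R) (v g w k : R -> R) : Prop := CorrectedMode {
  mode_ode : flux_ode (fun x => - (r `^ beta * v x)) v g ;
  corrector_ode :
    flux_ode (fun x => - (r `^ beta * w x) - beta / D * v x) w k ;
  mode_left : v 0 = 1 /\ g 0 = 0 ;
  corrector_left : w 0 = 0 /\ k 0 = 1 ;
  mode_right : g 1 = 0 ;
  corrector_right : k 1 = 0 ;
  corrector_small : forall x, 0 <= x <= 1 -> `|w x| <= C * r `^ (alpha - 1) ;
  mode_mass : (\int[leb]_(x in `[0%R, 1%R]) (v x ^+ 2)%:E = (D / beta)%:E)%E ;
  mode_mass_ge : c <= r `^ (alpha / 2) * D }.

(** In the variable y = r x, the corrector is G + y F' / (r F(r)^2).  Its flux at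
    r is q(r) - 1 / F(r), which vanishes because the Wronskian F q - p G equals 1
    and p(r) = 0. *)
Lemma corrected_modes : exists c C : R, [/\ 0 < c, 0 < C &
  forall B, exists r D v g w k,
    [/\ B <= r, 1 <= r & corrected_mode c C r D v g w k]].
Proof.
have [F [p [P [Fp Pc pE F0]]]] := regular_solution alpha_lt1.
have [G [q [Gq G0 q0]]] := singular_solution alpha_lt1.
have p0 : p 0 = 0 by rewrite pE mul0r.
have W (y : R) : 0 <= y -> F y * q y - p y * G y = 1.
  by move=> y0; rewrite (wronskian Fp Gq y0) F0 q0 p0 mul0r subr0 mulr1.
have Fp1 : (F 1, p 1) != (0, 0).
  apply/eqP => -[F1 p1]; have := W 1 ler01.
  by rewrite F1 p1 !mul0r subr0 => /esym/eqP; rewrite oner_eq0.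
have [c c0 cD] := amplitude_lower_bound alpha_gt0 alpha_lt1 Fp Fp1.
have [CG CGP] := bounded_solution Gq.
have CG0 : 0 <= CG by apply: le_trans (CGP 0 (lexx _)).
have ic0 : 0 < c^-1 by rewrite invr_gt0.
exists c, (CG + c^-1); split=> //; first exact: ltr_wpDl.
move=> B; have [r] := flux_zero alpha_lt1 (Num.max B 1) Fp.
rewrite ge_max => /andP[Br r1] pr.
have r0 := lt_le_trans ltr01 r1.
have Dc := cD r r1 pr; set D := F r ^+ 2 in Dc.
have D0 : 0 < D.
  by rewrite -(pmulr_rgt0 _ (powR_gt0 (alpha / 2) r0)) (lt_le_trans c0).
pose u (y : R) := `|y| `^ (1 - alpha).
have cu : continuous u by apply: continuous_abs_powR; rewrite subr_gt0.
have uE (y : R) : 0 < y -> u y = y / y `^ alpha.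
  by move=> y0; rewrite /u gtr0_norm// powRB ?(gt_eqF y0) ?implybT// powRr1 ?(ltW y0).
have du (y : R) : 0 < y -> is_derive y 1 u ((1 - alpha) / y `^ alpha).
  move=> y0; have := is_derive_abs_powR (1 - alpha) y0.
  by rewrite (_ : 1 - alpha - 1 = - alpha) ?powRN//; ring.
pose w y := G y + (r * D)^-1 * (u y * p y).
pose k y := q y + (r * D)^-1 * ((1 - alpha) * p y - y * F y).
have [Fc pc dF dp] := Fp; have [Gc qc dG dq] := Gq.
have wc : continuous w.
  move=> y; apply: cvgD; first exact: Gc.
  by apply: cvgM; [exact: cvg_cst|apply: cvgM; [exact: cu|exact: pc]].
have kc : continuous k.
  move=> y; apply: cvgD; first exact: qc.
  apply: cvgM; [exact: cvg_cst|apply: cvgB].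
    by apply: cvgM; [exact: cvg_cst|exact: pc].
  by apply: cvgM; [exact: cvg_id|exact: Fc].
have dw (y : R) : 0 < y -> is_derive y 1 w (k y / y `^ alpha).
  move=> y0; have D1 := dG y y0; have D2 := dp y y0; have D3 := du y y0.
  apply: is_derive_eq (is_deriveD D1
    (is_deriveM (is_derive_cst (r * D)^-1 y 1) (is_deriveM D3 D2))) _.
  rewrite /GRing.scale /= /cst /= ?mulrfctE (uE y y0) /k; field.
  by rewrite !gt_eqF ?powR_gt0.
have dk (y : R) : 0 < y -> is_derive y 1 k (- w y - beta * F y / (r * D)).
  move=> y0; have D1 := dq y y0; have D2 := dp y y0; have D3 := dF y y0.
  have D4 := is_deriveB (is_deriveM (is_derive_cst (1 - alpha) y 1) D2)
    (is_deriveM (is_derive_id y 1) D3).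
  apply: is_derive_eq
    (is_deriveD D1 (is_deriveM (is_derive_cst (r * D)^-1 y 1) D4)) _.
  rewrite /GRing.scale /= /cst /= /w (uE y y0); field.
  by rewrite !gt_eqF ?powR_gt0.
have cr : continuous (fun x => r * x : R).
  by move=> x; apply: cvgM; [exact: cvg_cst|exact: cvg_id].
have scale_cont h (a : R) : continuous h -> continuous (fun x => a * h (r * x)).
  move=> hc x; apply: cvgM; first exact: cvg_cst.
  by apply: (@continuous_comp _ _ _ ( *%R r) h); [exact: cr|exact: hc].
have scale_der h (dh : R -> R) (a : R) :
    (forall y : R, 0 < y -> is_derive y 1 h (dh y)) -> forall x : R, 0 < x ->
    is_derive x 1 (fun x => a * h (r * x)) (a * (r * dh (r * x))).
  move=> hd x x0; have D1 := hd (r * x) (mulr_gt0 r0 x0).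
  have D2 : is_derive x 1 (fun x : R => r * x) r.
    apply: (@is_derive_eq _ _ _ (cst r * id)).
    by rewrite /GRing.scale /= /cst mulr1 mulr0 addr0.
  have D3 := is_derive1_comp D1 D2.
  apply: (@is_derive_eq _ _ _ (cst a * (h \o (fun x : R => r * x)))).
  by rewrite /GRing.scale /= /cst mulr0 addr0; ring.
have r1a : r `^ (1 - alpha) = r / r `^ alpha.
  by rewrite powRB ?(gt_eqF r0) ?implybT// powRr1 ?(ltW r0).
have ra1 : r `^ (alpha - 1) = r `^ alpha / r.
  by rewrite powRB ?(gt_eqF r0) ?implybT// powRr1 ?(ltW r0).
have rb : r `^ beta = r * (r / r `^ alpha).
  by rewrite powRB ?(gt_eqF r0) ?implybT// powR_mulrn ?(ltW r0)// expr2 mulrA.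
have rxa x : 0 < x -> (r * x) `^ alpha = r `^ alpha * x `^ alpha.
  by move=> x0; rewrite powRM// ltW.
exists r, D, (fun x => 1 * F (r * x)), (fun x => r `^ (1 - alpha) * p (r * x)),
  (fun x => r `^ (alpha - 1) * w (r * x)), (fun x => 1 * k (r * x)).
split=> //; split.
- split; try exact: scale_cont.
  + move=> x x0; apply: is_derive_eq (scale_der _ _ 1 dF x x0) _.
    by rewrite r1a rxa//; field; rewrite !gt_eqF ?powR_gt0.
  + move=> x x0; apply: is_derive_eq (scale_der _ _ _ dp x x0) _.
    by rewrite r1a rb; field; rewrite !gt_eqF ?powR_gt0.
- split; try exact: scale_cont.
  + move=> x x0; apply: is_derive_eq (scale_der _ _ _ dw x x0) _.
    by rewrite ra1 rxa//; field; rewrite !gt_eqF ?powR_gt0.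
  + move=> x x0; apply: is_derive_eq (scale_der _ _ _ dk x x0) _.
    by rewrite ra1 rb; field; rewrite !gt_eqF ?powR_gt0.
- by rewrite mulr0 F0 p0 mulr0 mulr1.
- by rewrite mulr0 /w /k G0 p0 q0 !(mulr0, mul0r, addr0, subr0, mulr1).
- by rewrite mulr1 pr mulr0.
- rewrite !mulr1 mul1r /k pr mulr0 sub0r.
  have Fq : F r * q r = 1 by have := W r (ltW r0); rewrite pr mul0r subr0.
  have Fr : F r != 0 by apply/eqP => F_0; move: D0; rewrite /D F_0 expr0n ltxx.
  by rewrite -[q r](mulKf Fr) Fq /D; field; rewrite Fr gt_eqF.
- move=> x /andP[x0 x1]; rewrite normrM ger0_norm ?powR_ge0// mulrC.
  rewrite ler_wpM2r ?powR_ge0// /w (le_trans (ler_normD _ _))// lerD//.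
    by rewrite CGP// mulr_ge0 ?(ltW r0).
  have [->|xn0] := eqVneq x 0; first by rewrite mulr0 p0 !mulr0 normr0 ltW.
  have xp : 0 < x by rewrite lt_def xn0.
  have y0 : 0 < r * x by rewrite mulr_gt0.
  set y := r * x in y0 *.
  have yr : y <= r by rewrite ger_pMr.
  (* u y * p y = y F' y, which the energy bounds by y `^ (beta / 2) *)
  have up : `|u y * p y| <= r * r `^ (- (alpha / 2)).
    have : (u y * p y) ^+ 2 <= (r * r `^ (- (alpha / 2))) ^+ 2.
      have E1 := regular_energy_le1 Fp Pc pE F0 y0.
      have p2 : p y ^+ 2 / y `^ alpha <= 1.
        by apply: le_trans E1; rewrite lerDr sqr_ge0.
      have -> : (u y * p y) ^+ 2 = y * (y / y `^ alpha) * (p y ^+ 2 / y `^ alpha).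
        by rewrite uE//; field; rewrite gt_eqF ?powR_gt0.
      have yy0 : 0 <= y * (y / y `^ alpha).
        by apply: mulr_ge0 (ltW y0) (divr_ge0 (ltW y0) (powR_ge0 _ _)).
      apply: (le_trans (ler_piMr yy0 p2)).
      have -> : (r * r `^ (- (alpha / 2))) ^+ 2 = r `^ beta.
        rewrite exprMn -[X in _ * X]powR_mulrn ?powR_ge0// -powRrM.
        rewrite -[X in X * _]powR_mulrn ?(ltW r0)//.
        by rewrite -powRD ?(gt_eqF r0) ?implybT//; congr (_ `^ _); field.
      have -> : y * (y / y `^ alpha) = y `^ beta.
        rewrite powRB ?(gt_eqF y0) ?implybT// powR_mulrn ?(ltW y0)//.
        by rewrite expr2 mulrA.
      rewrite ge0_ler_powR ?nnegrE ?(ltW y0) ?(ltW r0)//.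
      by move: alpha_lt1; lra.
    rewrite -sqrtr_sqr => /ler_wsqrtr/le_trans; apply.
    by rewrite sqrtr_sqr ger0_norm// mulr_ge0 ?powR_ge0 ?(ltW r0).
  have rD0 : 0 < r * D by rewrite mulr_gt0.
  rewrite normrM gtr0_norm ?invr_gt0// mulrC ler_pdivrMr//.
  apply: (le_trans up); rewrite mulrCA ler_wpM2l ?(ltW r0)//.
  rewrite powRN [leRHS]mulrC ler_pdivlMr// [leLHS]mulrC.
  by rewrite ler_pdivrMr ?powR_gt0// mulrC.
- under eq_integral do rewrite mul1r.
  exact: (integral_sqr_regular Fp).
- by [].
Qed.

End quasimodes.

(** * Improper integrals and the memory kernel *)

Section improper_integrals.
Context (R : realType).
Local Notation leb := (@lebesgue_measure R).
Local Open Scope ereal_scope.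

Lemma integral_exhaustion_le d (T : measurableType d)
    (mu : {measure set T -> \bar R}) (F : (set T)^nat) (f : T -> \bar R) M :
  nondecreasing_seq F -> (forall n, measurable (F n)) ->
  measurable_fun setT f -> (forall x, 0 <= f x) ->
  (forall n, \int[mu]_(x in F n) f x <= M) ->
  \int[mu]_(x in \bigcup_n F n) f x <= M.
Proof.
move=> ndF mF mf f0 FM.
have := @ge0_nondecreasing_set_cvg_integral _ _ _ F f mu ndF mF
  (fun n => measurable_funTS mf) (fun _ x _ => f0 x).
move=> cv; rewrite -(cvg_lim _ cv)//; apply: lime_le; last exact: nearW.
by apply/cvg_ex; eexists; exact: cv.
Qed.

Let annulus n : set R := `[(n.+1%:R^-1)%R, n.+1%:R]%classic.
Let annulusN n : set R := `[(- n.+1%:R)%R, (- n.+1%:R^-1)%R]%classic.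

Let bigcup_annulus : \bigcup_n annulus n = `]0%R, +oo[%classic.
Proof.
apply/seteqP; split => [x [n _]|x]; rewrite /annulus /= !in_itv/= ?andbT.
  by move=> /andP[+ _]; apply: lt_le_trans; rewrite invr_gt0.
move=> x0; have := truncnS_gt (Num.max x x^-1)%R.
set n := Num.trunc _; rewrite gt_max => /andP[xn /ltW xVn].
exists n => //=; rewrite in_itv/= (ltW xn) andbT.
by rewrite -[leRHS]invrK lef_pV2// posrE// invr_gt0.
Qed.

Let annulus_nondecreasing : nondecreasing_seq annulus.
Proof.
move=> m n mn; rewrite subsetEset => x; rewrite /annulus /= !in_itv/=.
move=> /andP[mx xm]; rewrite (le_trans xm) ?ler_nat// andbT.
by rewrite (le_trans _ mx)// lef_pV2 ?posrE// ler_nat.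
Qed.

Lemma integral_posreal_le (f : R -> R) M : measurable_fun setT f ->
  (forall x, 0 <= f x)%R ->
  (forall a b : R, (0 < a)%R -> (a <= b)%R ->
    \int[leb]_(x in `[a, b]) (f x)%:E <= M) ->
  \int[leb]_(x in `]0%R, +oo[) (f x)%:E <= M.
Proof.
move=> mf f0 fM; rewrite -bigcup_annulus; apply: integral_exhaustion_le => //.
- by move=> n; exact: measurable_itv.
- exact/measurable_EFinP.
- move=> n; apply: fM; first by rewrite invr_gt0.
  by rewrite (@le_trans _ _ 1%R) ?invf_le1 ?ler1n.
Qed.

(** Only bounds on compact subintervals of the positive half-line are assumed,
    so that the integrand may be singular at 0. *)
Lemma integral_even_le (f : R -> R) M : measurable_fun setT f ->
  (forall x, 0 <= f x)%R -> (forall x, f (- x) = f x)%R ->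
  (forall x : R, (0 < x)%R -> {for x, continuous f}) ->
  (forall a b : R, (0 < a)%R -> (a <= b)%R ->
    \int[leb]_(x in `[a, b]) (f x)%:E <= M) ->
  \int[leb]_x (f x)%:E <= M + M.
Proof.
move=> mf f0 fN fc fM; have mfE : measurable_fun setT (EFin \o f).
  exact/measurable_EFinP.
have -> : [set: R] = `]-oo, 0%R[%classic `|` `[0%R, +oo[%classic.
  by rewrite -setCitvl setUv.
rewrite ge0_integral_setU//=; last 3 first.
- exact: measurable_funTS.
- by move=> x _ /=; rewrite lee_fin.
- by rewrite -setCitvl; apply/disj_setPCl.
apply: leeD; last first.
  rewrite -integral_itv_obnd_cbnd; last exact: measurable_funTS.
  exact: integral_posreal_le.
have -> : `]-oo, 0%R[%classic = \bigcup_n annulusN n :> set R.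
  have := bigcup_annulus; move=> /seteqP[s1 s2].
  apply/seteqP; split => [x|x [n _]]; rewrite /annulusN /= !in_itv/=.
    move=> x0; have [|n _] := s2 (- x)%R; first by rewrite /= in_itv/= oppr_gt0 x0.
    rewrite /annulus /= in_itv/= => /andP[nx xn]; exists n => //=.
    by rewrite in_itv/= lerNl xn lerNr nx.
  by move=> /andP[_]; move/le_lt_trans; apply; rewrite oppr_lt0 invr_gt0.
apply: integral_exhaustion_le => //.
- move=> m n mn; have := annulus_nondecreasing mn; rewrite !subsetEset => s x.
  have := s (- x)%R; rewrite /annulus /annulusN /= !in_itv/=.
  move=> + /andP[h1 h2]; rewrite lerNr h2 lerNl h1 => /(_ isT) /andP[h3 h4].
  by rewrite lerNl h4 lerNr h3.
- by move=> n; exact: measurable_itv.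
- move=> n; have nn : (n.+1%:R^-1 <= n.+1%:R :> R)%R.
    by rewrite (@le_trans _ _ 1%R) ?invf_le1 ?ler1n.
  rewrite /annulusN (@integration_by_substitution_oppr _ f)//.
    under eq_integral do rewrite /= fN.
    by apply: fM nn; rewrite invr_gt0.
  apply/continuous_in_subspaceT => x; rewrite inE /= in_itv/= => /andP[_ xn].
  have -> : f = f \o -%R by apply/funext => y /=; rewrite fN.
  apply: continuous_comp; first exact: opp_continuous.
  by apply: fc; rewrite oppr_gt0 (le_lt_trans xn)// oppr_lt0 invr_gt0.
Qed.

Lemma integral_deriv (f Phi : R -> R) (a b : R) : (0 < a)%R -> (a <= b)%R ->
  (forall x : R, (0 < x)%R -> is_derive x 1%R Phi (f x)) ->
  (forall x : R, (0 < x)%R -> {for x, continuous f}) ->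
  \int[leb]_(x in `[a, b]) (f x)%:E = (Phi b - Phi a)%:E.
Proof.
move=> a0 ab dP fc; have c0 x : (a <= x)%R -> (0 < x)%R by exact: lt_le_trans.
move: ab; rewrite le_eqVlt => /predU1P[<-|ab].
  by rewrite set_itv1 integral_set1 subrr.
have Pc x : (0 < x)%R -> {for x, continuous Phi}.
  by move=> /dP[+ _] => /derivable1_diffP/differentiable_continuous.
rewrite (@continuous_FTC2 _ f Phi)//.
- apply: continuous_in_subspaceT => x; rewrite inE /= in_itv/= => /andP[ax _].
  exact/fc/c0.
- split.
  + by move=> x; rewrite in_itv/= => /andP[/ltW ax _]; have [] := dP x (c0 x ax).
  + by apply: cvg_at_right_filter; exact: Pc.
  + by apply: cvg_at_left_filter; apply/Pc/c0/ltW.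
- move=> x; rewrite in_itv/= => /andP[/ltW ax _].
  by rewrite derive1E; have [_ ->] := dP x (c0 x ax).
Qed.

Lemma powR_continuous (s x : R) : (0 < x)%R ->
  {for x, continuous (fun x : R => (x `^ s)%R)}.
Proof.
move=> x0; have [+ _] := is_derive1_powR s x0.
by move=> /derivable1_diffP/differentiable_continuous.
Qed.

Lemma integrable_powR_near0 (s : R) : (s < 1)%R ->
  leb.-integrable `]0%R, 1%R[ (fun x => (x `^ (- s))%R%:E).
Proof.
move=> s1; have s10 : (0 < 1 - s)%R by rewrite subr_gt0.
have mp : measurable_fun setT (EFin \o (fun x : R => (x `^ (- s))%R)).
  by apply/measurable_EFinP; exact: measurable_powR.
apply/integrableP; split; first exact: measurable_funTS.
under eq_integral do rewrite gee0_abs ?lee_fin ?powR_ge0//.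
apply: (@le_lt_trans _ _ ((1 - s)^-1)%:E); last exact: ltry.
pose F n : set R := `[(n.+1%:R^-1)%R, 1%R]%classic.
have UF : `]0%R, 1%R[%classic `<=` \bigcup_n F n.
  move=> x /=; rewrite in_itv/= => /andP[x0 x1].
  have := truncnS_gt (x^-1)%R; set n := Num.trunc _ => /ltW xn.
  exists n => //; rewrite /F /= in_itv/= (ltW x1) andbT.
  by rewrite -[leRHS]invrK lef_pV2// posrE// invr_gt0.
apply: (@le_trans _ _ (\int[leb]_(x in \bigcup_n F n) (x `^ (- s))%R%:E)).
  apply: ge0_subset_integral => //.
  - by apply: bigcup_measurable => n _; exact: measurable_itv.
  - exact: measurable_funTS.
  - by move=> x _; rewrite lee_fin powR_ge0.
apply: integral_exhaustion_le => //.
- move=> m n mn; rewrite subsetEset => x; rewrite /F /= !in_itv/=.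
  move=> /andP[mx ->]; rewrite andbT (le_trans _ mx)//.
  by rewrite lef_pV2 ?posrE// ler_nat.
- by move=> n; exact: measurable_itv.
- by move=> x; rewrite lee_fin powR_ge0.
move=> n; have D (x : R) : (0 < x)%R ->
    is_derive x 1%R (fun x : R => ((1 - s)^-1 * x `^ (1 - s))%R) (x `^ (- s))%R.
  move=> x0; have D := is_derive1_powR (1 - s) x0.
  apply: is_derive_eq (is_deriveM (is_derive_cst (1 - s)^-1%R x 1%R) D) _.
  rewrite /GRing.scale /= /cst /= mulr0 addr0 mulKf ?gt_eqF//.
  by congr (_ `^ _)%R; ring.
rewrite (integral_deriv _ _ D (@powR_continuous (- s))) ?invr_gt0//; last first.
  by rewrite invf_le1 ?ler1n.
by rewrite lee_fin powR1 mulr1 gerBl mulr_ge0 ?invr_ge0 ?powR_ge0 ?(ltW s10).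
Qed.

End improper_integrals.

Section memory_weight.
Context (R : realType).
Local Notation leb := (@lebesgue_measure R).
Implicit Types (t om x : R).

(** For om >= 1 this function dominates, up to a factor 2, the integrands
    |phi|^2, |xi phi|^2 and |mu phi| attached to the memory variable phi. *)
Definition weight t om x : R := `|x| `^ (2 * t - 1) / (om + x ^+ 2).

Lemma weight_ge0 t om x : 0 < om -> 0 <= weight t om x.
Proof. by move=> om0; rewrite divr_ge0 ?powR_ge0// addr_ge0 ?sqr_ge0// ltW. Qed.

Lemma weight_continuous t om x : 0 < om -> 0 < x ->
  {for x, continuous (weight t om)}.
Proof.
move=> om0 x0.
have [+ _] := is_derive_abs_powR (2 * t - 1) x0.
move=> /derivable1_diffP/differentiable_continuous c1.
apply: cvgM; first exact: c1.
apply: cvgV; first by rewrite gt_eqF// ltr_wpDr ?sqr_ge0.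
apply: cvgD; first exact: cvg_cst.
by apply: cvgM; exact: cvg_id.
Qed.

Lemma measurable_weight t om : 0 < om -> measurable_fun setT (weight t om).
Proof.
move=> om0; apply: measurable_funM.
  exact: (@measurableT_comp _ _ _ _ _ _ (fun x : R => x `^ (2 * t - 1))).
apply: continuous_measurable_fun => x.
apply: cvgV; first by rewrite gt_eqF// ltr_wpDr ?sqr_ge0.
apply: cvgD; first exact: cvg_cst.
by apply: cvgM; exact: cvg_id.
Qed.

(** The growth rate om^(t - 1) is the one given by the scaling
    x = om^(1 / 2) y. *)
Lemma integral_weight_le t om : 0 < t < 1 -> 0 < om ->
  (\int[leb]_x (weight t om x)%:E <=
    (2 / Num.min t (1 - t) * om `^ (t - 1))%:E)%E.
Proof.
move=> /andP[t0 t1] om0; have t10 : 0 < 1 - t by rewrite subr_gt0.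
set kap := Num.min t (1 - t); have kap0 : 0 < kap by rewrite lt_min t0.
have -> : ((2 / kap * om `^ (t - 1))%:E =
    (kap^-1 * om `^ (t - 1))%:E + (kap^-1 * om `^ (t - 1))%:E)%E.
  by rewrite -EFinD; congr EFin; ring.
apply: integral_even_le.
- exact: measurable_weight.
- by move=> x; exact: weight_ge0.
- by move=> x; rewrite /weight normrN sqrrN.
- by move=> x x0; exact: weight_continuous.
move=> a b a0 ab.
(* Phi is bounded by om^(t - 1) in absolute value; in its derivative, the first
   term controls the weight for x^2 <= om and the second one for x^2 >= om *)
pose N x := om + x ^+ 2.
have N0 x : 0 < N x by rewrite ltr_wpDr ?sqr_ge0.
pose Phi x := om `^ (t - 1) * (x `^ (2 * t) * N x `^ (- t)) - N x `^ (t - 1).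
pose phi x := 2 * t * om `^ t * (x `^ (2 * t - 1) * N x `^ (- t - 1)) +
  2 * (1 - t) * (x * N x `^ (t - 2)).
have dN x : is_derive x 1 N (2 * x).
  apply: is_derive_eq (is_deriveD (is_derive_cst om x 1)
    (is_deriveX 2 (is_derive_id x 1))) _.
  by rewrite add0r /GRing.scale /= mulr1 expr1.
have powE x s : 0 < x -> [/\ x `^ (- s) = (x `^ s)^-1,
    x `^ (s - 1) = x `^ s / x, x `^ (- s - 1) = (x `^ s)^-1 / x &
    x `^ (s - 2) = x `^ s / x ^+ 2].
  move=> x0; split; first by rewrite powRN.
  - by rewrite powRB ?(gt_eqF x0) ?implybT// powRr1 ?(ltW x0).
  - by rewrite powRB ?(gt_eqF x0) ?implybT// powRr1 ?(ltW x0)// powRN.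
  - by rewrite powRB ?(gt_eqF x0) ?implybT// powR_mulrn ?(ltW x0).
have dPhi x : 0 < x -> is_derive x 1 Phi (phi x).
  move=> x0; have D1 := is_derive1_powR (2 * t) x0.
  have D2 s := is_derive1_comp (is_derive1_powR s (N0 x)) (dN x).
  have D3 := is_deriveM (is_derive_cst (om `^ (t - 1)) x 1)
    (is_deriveM D1 (D2 (- t))).
  apply: is_derive_eq (is_deriveB D3 (D2 (t - 1))) _.
  rewrite /GRing.scale /= /cst /= ?mulrfctE /phi /=.
  have -> : t - 1 - 1 = t - 2 by ring.
  have [E1 E2 E3 E4] := powE _ t (N0 x); rewrite E1 E3 E4.
  have [_ -> _ _] := powE _ (2 * t) x0; have [_ -> _ _] := powE _ t om0.
  have NE : N x = om + x ^+ 2 by [].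
  have Nn : om + x ^+ 2 != 0 by rewrite -NE gt_eqF.
  set B := N x `^ t; have B0 : B != 0 by rewrite gt_eqF ?powR_gt0.
  by rewrite NE; field; rewrite Nn B0 !gt_eqF.
have phic x : 0 < x -> {for x, continuous phi}.
  move=> x0; have Nc s : {for x, continuous (fun x => N x `^ s)}.
    have [+ _] := is_derive1_comp (is_derive1_powR s (N0 x)) (dN x).
    by move=> /derivable1_diffP/differentiable_continuous.
  apply: cvgD; apply: cvgM; [exact: cvg_cst| |exact: cvg_cst|].
    by apply: cvgM; [exact: powR_continuous|exact: Nc].
  by apply: cvgM; [exact: cvg_id|exact: Nc].
have k20 : 0 < 2 * kap by rewrite mulr_gt0.
have wphi x : 0 < x -> weight t om x <= (2 * kap)^-1 * phi x.
  move=> x0; rewrite mulrC ler_pdivlMr// /weight gtr0_norm// -/(N x) /phi.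
  have le_pow (y s : R) : 0 < y <= 1 -> s <= 1 -> y <= y `^ s.
    move=> y01 s1; have /andP[y0 _] := y01.
    by rewrite -{1}[y]powRr1 ?(ltW y0)// ger_powR.
  have powV (y s : R) : 0 < y -> y^-1 `^ s = (y `^ s)^-1.
    by move=> y0; rewrite -(powR_inv1 (ltW y0)) -powRrM mulN1r powRN.
  set A := x `^ (2 * t); set B := N x `^ t; set W := om `^ t.
  have A0 : 0 < A by rewrite powR_gt0.
  have B0 : 0 < B by rewrite powR_gt0.
  have r1 : om / N x <= W / B.
    rewrite /B -powV// /W -powRM ?invr_ge0 ?(ltW om0) ?(ltW (N0 x))//.
    apply: le_pow (ltW t1); rewrite divr_gt0//= ler_pdivrMr// mul1r.
    by rewrite lerDl sqr_ge0.
  have r2 : x ^+ 2 / N x <= x ^+ 2 * B / (N x * A).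
    have -> : x ^+ 2 * B / (N x * A) = (x ^+ 2 / N x) `^ (1 - t).
      rewrite powRM ?invr_ge0 ?sqr_ge0 ?(ltW (N0 x))// powV//.
      have -> : (x ^+ 2) `^ (1 - t) = x ^+ 2 / A.
        rewrite -powR_mulrn ?(ltW x0)// -powRrM mulrBr mulr1.
        by rewrite powRB ?(gt_eqF x0) ?implybT.
      rewrite powRB ?(gt_eqF (N0 x)) ?implybT// powRr1 ?(ltW (N0 x))//.
      by rewrite -/B; field; rewrite !gt_eqF.
    apply: le_pow; last by rewrite gerBl ltW.
    by rewrite divr_gt0 ?exprn_gt0//= ler_pdivrMr// mul1r lerDr ltW.
  have [_ -> _ _] := powE _ (2 * t) x0; have [_ _ -> ->] := powE _ t (N0 x).
  rewrite -/A -/B -/W.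
  have -> : 2 * t * W * (A / x * (B^-1 / N x)) + 2 * (1 - t) * (x * (B / N x ^+ 2))
     = 2 * (A / x / N x) * (t * (W / B) + (1 - t) * (x ^+ 2 * B / (N x * A))).
    by field; rewrite !gt_eqF.
  rewrite mulrCA mulrA ler_wpM2l ?mulr_ge0 ?invr_ge0 ?(ltW x0) ?(ltW (N0 x)) ?(ltW A0)//.
  have kE : kap = kap * (om / N x) + kap * (x ^+ 2 / N x).
    by rewrite -mulrDr -mulrDl -/(N x) divff ?mulr1// gt_eqF.
  rewrite kE lerD//.
    have o0 : 0 <= om / N x by rewrite divr_ge0 ?(ltW om0) ?(ltW (N0 x)).
    by apply: ler_pM (ltW kap0) o0 _ r1; rewrite ge_min lexx.
  have o0 : 0 <= x ^+ 2 / N x by rewrite divr_ge0 ?sqr_ge0 ?(ltW (N0 x)).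
  by apply: ler_pM (ltW kap0) o0 _ r2; rewrite ge_min lexx orbT.
pose c := (2 * kap)^-1.
have D x : 0 < x -> is_derive x 1 (fun x => c * Phi x) (c * phi x).
  move=> x0; apply: is_derive_eq (is_deriveM (is_derive_cst c x 1) (dPhi x x0)) _.
  by rewrite /GRing.scale /= mulr0 addr0.
have C x : 0 < x -> {for x, continuous (fun x => c * phi x)}.
  by move=> x0; apply: cvgM; [exact: cvg_cst|exact: phic].
have Cab : {within `[a, b], continuous (fun x => c * phi x)}.
  apply: continuous_in_subspaceT => x; rewrite inE /= in_itv/= => /andP[ax _].
  exact/C/(lt_le_trans a0).
apply: (@le_trans _ _ (\int[leb]_(x in `[a, b]) (c * phi x)%:E)%E).
  apply: ge0_le_integral => //.
  - by move=> x _; rewrite lee_fin weight_ge0.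
  - by apply: measurable_funTS; apply/measurable_EFinP; exact: measurable_weight.
  - apply/measurable_EFinP; exact: subspace_continuous_measurable_fun.
  - move=> x; rewrite /= in_itv/= => /andP[ax _]; have x0 := lt_le_trans a0 ax.
    by rewrite lee_fin wphi.
rewrite (integral_deriv a0 ab D C) lee_fin -mulrBr.
rewrite /c invfM -mulrA [leLHS]mulrCA ler_wpM2l ?invr_ge0 ?(ltW kap0)//.
have om1 x : 0 < x -> N x `^ (t - 1) <= om `^ (t - 1).
  move=> x0; have -> : t - 1 = - (1 - t) by ring.
  rewrite !powRN lef_pV2 ?posrE ?powR_gt0//.
  rewrite ge0_ler_powR ?nnegrE ?(ltW t10) ?(ltW om0) ?(ltW (N0 x))//.
  by rewrite lerDl sqr_ge0.
have Phile x : 0 < x -> Phi x <= om `^ (t - 1).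
  move=> x0; rewrite lerBlDr.
  apply: (@le_trans _ _ (om `^ (t - 1))); last by rewrite lerDl powR_ge0.
  rewrite ler_piMr ?powR_ge0// powRN ler_pdivrMr ?powR_gt0// mul1r.
  rewrite powRrM powR_mulrn ?(ltW x0)//.
  by rewrite ge0_ler_powR ?nnegrE ?sqr_ge0 ?(ltW t0) ?(ltW (N0 x))// lerDr ltW.
have Phige x : 0 < x -> - om `^ (t - 1) <= Phi x.
  move=> x0; rewrite -[leLHS]add0r lerD// ?lerN2 ?om1//.
  by rewrite !mulr_ge0 ?powR_ge0.
have b0 := lt_le_trans a0 ab.
have := Phile b b0; have := Phige a a0.
by rewrite mulrC ler_pdivrMr//; lra.
Qed.

End memory_weight.

(** * Membership in the weighted Sobolev spaces *)

Section H2_membership.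
Context (R : realType) (alpha : R).
Hypotheses (alpha_gt0 : 0 < alpha) (alpha_lt1 : alpha < 1).
Local Notation leb := (@lebesgue_measure R).
Local Open Scope complex_scope.

Definition cpx (a b : R -> R) (x : R) : R[i] := a x +i* b x.

Lemma eq_in_L2_01 (f g : R -> R[i]) : (forall x, 0 < x < 1 -> f x = g x) ->
  in_L2_01 f -> in_L2_01 g.
Proof.
move=> fg.
have fgI : {in @I01 R, f =1 g}.
  by move=> x; rewrite inE /I01 /= in_itv/=; exact: fg.
case=> mr mi fi; split.
- apply: eq_measurable_fun mr => x xI /=; congr complex.Re; exact: fgI.
- apply: eq_measurable_fun mi => x xI /=; congr complex.Im; exact: fgI.
- by apply: (eq_integrable (@measurable_I01 R) _ _ _ fi) => x xI; rewrite fgI.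
Qed.

Lemma integrable_I01_le (h : R -> R) (C s : R) : measurable_fun (@I01 R) h ->
  s < 1 -> (forall x, 0 < x < 1 -> `|h x| <= C * x `^ (- s)) ->
  leb.-integrable (@I01 R) (fun x => (h x)%:E).
Proof.
move=> mh s1 hC.
apply: (@le_integrable _ _ _ _ _ (@measurable_I01 R) _ (fun x => (C * x `^ (- s))%:E)).
- exact/measurable_EFinP.
- move=> x; rewrite /I01 /= in_itv/= => x01; rewrite lee_fin.
  by rewrite (le_trans (hC x x01))// ler_norm.
- under eq_fun do rewrite EFinM.
  by apply: integrableZl; [exact: measurable_I01|exact: integrable_powR_near0].
Qed.

Lemma continuous_bounded01 (a : R -> R) : continuous a ->
  exists2 C : R, 0 <= C & forall x, 0 <= x <= 1 -> `|a x| <= C.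
Proof.
move=> ac.
have nc : {within `[0, 1], continuous (fun y => `|a y|)}.
  by apply: continuous_subspaceT => y; apply: cvg_norm; exact: ac.
have [c /= _ hmax] := EVT_max ler01 nc.
by exists `|a c| => // x x01; apply: hmax; rewrite in_itv.
Qed.

(** The condition on [s] makes x^(- 2 s) integrable at 0. *)
Lemma in_L2_01_weighted (a b : R -> R) (s : R) : continuous a -> continuous b ->
  s < 1 / 2 -> in_L2_01 (fun x => (x `^ (- s))%:C * cpx a b x).
Proof.
move=> ac bc s1.
have mp : measurable_fun (@I01 R) (fun x : R => x `^ (- s)).
  by apply: measurable_funTS; exact: measurable_powR.
have mc (h : R -> R) : continuous h -> measurable_fun (@I01 R) h.
  by move=> hc; apply: measurable_funTS; exact: continuous_measurable_fun.
have mr : measurable_fun (@I01 R)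
    (fun x => complex.Re ((x `^ (- s))%:C * cpx a b x)).
  under eq_fun do rewrite /= mul0r subr0.
  by apply: measurable_funM => //; exact: mc.
have mi : measurable_fun (@I01 R)
    (fun x => complex.Im ((x `^ (- s))%:C * cpx a b x)).
  under eq_fun do rewrite /= mul0r addr0.
  by apply: measurable_funM => //; exact: mc.
split=> //.
have [A A0 aA] := continuous_bounded01 ac.
have [B B0 bB] := continuous_bounded01 bc.
apply: (@integrable_I01_le _ (A ^+ 2 + B ^+ 2) (2 * s)).
- exact: measurable_normc2.
- lra.
- move=> x /andP[x0 x1]; have x01 : 0 <= x <= 1 by rewrite !ltW.
  rewrite ger0_norm ?sqr_ge0// normcM exprMn mulrC ler_pM ?sqr_ge0//.
    rewrite normc2E /= lerD//.
      by rewrite -[leLHS]real_normK ?num_real// lerXn2r ?nnegrE// aA.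
    by rewrite -[leLHS]real_normK ?num_real// lerXn2r ?nnegrE// bB.
  rewrite normc2E /= expr0n addr0 -powR_mulrn ?powR_ge0// -powRrM.
  by rewrite mulNr mulrC.
Qed.

Lemma in_L2_01_continuous (a b : R -> R) : continuous a -> continuous b ->
  in_L2_01 (cpx a b).
Proof.
move=> ac bc; apply: eq_in_L2_01 (in_L2_01_weighted (s := 0) ac bc _); last lra.
by move=> x _; rewrite oppr0 powRr0 mul1r.
Qed.

Lemma lipschitz_abs_continuous (a b L : R) (f : R -> R[i]) : 0 <= L ->
  (forall s t, a <= s -> s <= t -> t <= b -> normc (f t - f s) <= L * (t - s)) ->
  abs_continuous a b f.
Proof.
move=> L0 fL e e0; have L1 : 0 < L + 1 by rewrite ltr_wpDl.
exists (e / (L + 1)); first by rewrite divr_gt0.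
move=> n s t st _; rewrite ltr_pdivlMr// => lte.
apply: le_lt_trans lte; rewrite mulr_suml; apply: ler_sum => i _.
have [as_ st_ tb] := st i; rewrite (le_trans (fL _ _ as_ st_ tb))// mulrC.
by rewrite ler_wpM2l ?subr_ge0// lerDl.
Qed.

Lemma derive_bounded_lipschitz (h dh : R -> R) (a b L : R) : 0 <= a ->
  continuous h -> (forall x : R, 0 < x -> is_derive x 1 h (dh x)) ->
  (forall x, a < x -> x < b -> `|dh x| <= L) ->
  forall s t, a <= s -> s <= t -> t <= b -> `|h t - h s| <= L * (t - s).
Proof.
move=> a0 hc hd dL s t as_; rewrite le_eqVlt => /predU1P[<-|st] tb.
  by rewrite !subrr normr0 mulr0.
have hd' x : x \in `]s, t[ -> is_derive x 1 h (dh x).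
  rewrite in_itv/= => /andP[sx _]; apply: hd.
  by rewrite (le_lt_trans _ sx)// (le_trans a0).
have [x] := MVT st hd' (continuous_subspaceT hc).
rewrite in_itv/= => /andP[sx xt] ->.
rewrite normrM (gtr0_norm (_ : 0 < t - s)) ?subr_gt0//.
rewrite ler_wpM2r ?subr_ge0 ?(ltW st)//.
by apply: dL; [exact: le_lt_trans sx|exact: lt_le_trans tb].
Qed.

Lemma normc_le_sum (x y : R) : normc (x +i* y) <= `|x| + `|y|.
Proof.
rewrite -[leRHS]ger0_norm ?addr_ge0// -sqrtr_sqr /= ler_wsqrtr// sqrrD.
rewrite -!normrX !(ger0_norm (sqr_ge0 _)) addrAC lerDl.
by rewrite mulrn_wge0// mulr_ge0.
Qed.

Lemma cpx_abs_continuous (h1 dh1 h2 dh2 : R -> R) (a L : R) : 0 <= a -> 0 <= L ->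
  continuous h1 -> (forall x : R, 0 < x -> is_derive x 1 h1 (dh1 x)) ->
  continuous h2 -> (forall x : R, 0 < x -> is_derive x 1 h2 (dh2 x)) ->
  (forall x, a < x -> x < 1 -> `|dh1 x| <= L) ->
  (forall x, a < x -> x < 1 -> `|dh2 x| <= L) ->
  abs_continuous a 1 (cpx h1 h2).
Proof.
move=> a0 L0 c1 d1 c2 d2 b1 b2.
apply: (@lipschitz_abs_continuous _ _ (L + L)) => [|s t as_ st tb].
  exact: addr_ge0.
rewrite (le_trans (normc_le_sum _ _))// mulrDl lerD//.
  exact: (derive_bounded_lipschitz a0 c1 d1 b1).
exact: (derive_bounded_lipschitz a0 c2 d2 b2).
Qed.

Lemma cderive_cpx (h1 dh1 h2 dh2 : R -> R) (x : R) :
  (forall x : R, 0 < x -> is_derive x 1 h1 (dh1 x)) ->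
  (forall x : R, 0 < x -> is_derive x 1 h2 (dh2 x)) ->
  0 < x -> cderive (cpx h1 h2) x = cpx dh1 dh2 x.
Proof.
move=> d1 d2 x0; rewrite /cderive /cpx /= !derive1E.
by have [_ ->] := d1 x x0; have [_ ->] := d2 x x0.
Qed.

(** The flux has a bounded derivative, hence is Lipschitz up to 0.  The solution
    is only Lipschitz away from 0, and its weighted derivative is
    x^(- alpha / 2) times a continuous function. *)
Lemma in_H2_alpha_flux_ode (e1 v1 g1 e2 v2 g2 : R -> R) :
  continuous e1 -> flux_ode alpha e1 v1 g1 ->
  continuous e2 -> flux_ode alpha e2 v2 g2 ->
  in_H2_alpha alpha (cpx v1 v2) (cpx g1 g2).
Proof.
move=> e1c [v1c g1c dv1 dg1] e2c [v2c g2c dv2 dg2].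
have dvE x : 0 < x < 1 -> cderive (cpx v1 v2) x =
    (x `^ (- alpha))%:C * cpx g1 g2 x.
  move=> /andP[x0 _]; rewrite (cderive_cpx dv1 dv2 x0) powRN.
  by rewrite /cpx; simpc; rewrite ![_ / _]mulrC.
split; first split.
- exact: in_L2_01_continuous.
- move=> a a0 a1; have [L1 L10 b1] := continuous_bounded01 g1c.
  have [L2 L20 b2] := continuous_bounded01 g2c.
  have bound (g : R -> R) (L : R) :
      0 <= L -> (forall x, 0 <= x <= 1 -> `|g x| <= L) -> forall x, a < x -> x < 1 ->
      `|g x / x `^ alpha| <= L / a `^ alpha.
    move=> L0 gL x ax x1; have x0 := lt_trans a0 ax.
    rewrite normrM normfV (ger0_norm (powR_ge0 _ _)) ler_pM ?invr_ge0 ?powR_ge0//.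
      by rewrite gL// !ltW.
    rewrite lef_pV2 ?posrE ?powR_gt0//.
    by rewrite ge0_ler_powR ?nnegrE ?(ltW a0) ?(ltW x0) ?(ltW alpha_gt0) ?(ltW ax).
  have p0 : 0 <= (a `^ alpha)^-1 by rewrite invr_ge0 powR_ge0.
  apply: (@cpx_abs_continuous _ _ _ _ _ ((L1 + L2) / a `^ alpha) (ltW a0) _
    v1c dv1 v2c dv2).
  + by rewrite mulr_ge0// addr_ge0.
  + move=> x ax x1; rewrite (le_trans (bound _ _ L10 b1 x ax x1))//.
    by rewrite ler_wpM2r// lerDl.
  + move=> x ax x1; rewrite (le_trans (bound _ _ L20 b2 x ax x1))//.
    by rewrite ler_wpM2r// lerDr.
- apply: eq_in_L2_01 (in_L2_01_weighted (s := alpha / 2) g1c g2c _).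
    move=> x x01; rewrite dvE// mulrA; congr (_ * _).
    have /andP[x0 _] := x01; rewrite -rmorphM/= -powRD ?(gt_eqF x0) ?implybT//.
    by congr ((_ `^ _)%:C); field.
  by move: alpha_lt1; lra.
- have c0 : (fun x => `|v1 x - v1 0| + `|v2 x - v2 0|) x @[x --> 0^'+] --> (0 : R).
    have cc (v : R -> R) : continuous v -> `|v x - v 0| @[x --> 0^'+] --> (0 : R).
      move=> vc; apply: cvg_at_right_filter.
      have : `|v x - v 0| @[x --> (0 : R)] --> `|v 0 - v 0|.
        by apply: cvg_norm; apply: cvgB; [exact: vc|exact: cvg_cst].
      by rewrite subrr normr0.
    have := cvgD (cc _ v1c) (cc _ v2c); rewrite addr0; exact.
  apply: squeeze_cvgr c0; last exact: cvg_cst.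
  by apply: nearW => x; rewrite Defs.normc_ge0 normc_le_sum.
- split; first exact: in_L2_01_continuous.
    have [L1 L10 b1] := continuous_bounded01 e1c.
    have [L2 L20 b2] := continuous_bounded01 e2c.
    apply: (@cpx_abs_continuous _ _ _ _ _ (L1 + L2) _ _ g1c dg1 g2c dg2) => //.
    + exact: addr_ge0.
    + by move=> x x0 x1; rewrite (le_trans (b1 _ _)) ?lerDl// !ltW.
    + by move=> x x0 x1; rewrite (le_trans (b2 _ _)) ?lerDr// !ltW.
  apply: eq_in_L2_01 (in_L2_01_continuous e1c e2c) => x /andP[x0 _].
  by rewrite (cderive_cpx dg1 dg2 x0).
- apply: aeW => x; rewrite /I01 /= in_itv/= => x01; rewrite dvE// mulrA.
  have /andP[x0 _] := x01; rewrite -rmorphM/= -powRD ?(gt_eqF x0) ?implybT//.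
  by rewrite subrr powRr0 mul1r.
Qed.

Lemma flux_ode_lin (c : R) (e v g e' v' g' : R -> R) :
  flux_ode alpha e v g -> flux_ode alpha e' v' g' ->
  flux_ode alpha (fun x => e x + c * e' x) (fun x => v x + c * v' x)
    (fun x => g x + c * g' x).
Proof.
move=> [vc gc dv dg] [vc' gc' dv' dg'].
have lc (h h' : R -> R) : continuous h -> continuous h' ->
    continuous (fun x => h x + c * h' x).
  move=> hc hc' x; apply: cvgD; first exact: hc.
  by apply: cvgM; [exact: cvg_cst|exact: hc'].
have ld (h h' : R -> R) (x d d' : R) : is_derive x 1 h d ->
    is_derive x 1 h' d' -> is_derive x 1 (fun x => h x + c * h' x) (d + c * d').
  move=> D D'; apply: is_derive_eq
    (is_deriveD D (is_deriveM (is_derive_cst c x 1) D')) _.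
  by rewrite /GRing.scale /= mulr0 addr0.
split; [exact: lc|exact: lc| |].
- move=> x x0; apply: is_derive_eq (ld _ _ _ _ _ (dv x x0) (dv' x x0)) _.
  by rewrite mulrDl mulrA.
- by move=> x x0; exact: (ld _ _ _ _ _ (dg x x0) (dg' x x0)).
Qed.

End H2_membership.

(** * The memory variable *)

Section memory_component.
Context (R : realType) (t eta : R).
Hypotheses (t01 : 0 < t < 1) (eta_ge0 : 0 <= eta).
Local Notation leb := (@lebesgue_measure R).
Local Notation mu := (mu_weight t).
Local Open Scope complex_scope.

(** The real and imaginary parts of mu / (xi^2 + eta + i om). *)
Definition memory (om xi : R) : R[i] :=
  let d := (xi ^+ 2 + eta) ^+ 2 + om ^+ 2 in
  (mu xi * ((xi ^+ 2 + eta) / d)) +i* (mu xi * (- om / d)).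

Lemma sqr_mu_weight xi : mu xi ^+ 2 = `|xi| `^ (2 * t - 1).
Proof.
rewrite /mu_weight -powR_mulrn ?powR_ge0// -powRrM.
by congr (_ `^ _); field.
Qed.

Lemma measurable_mu_weight : measurable_fun setT mu.
Proof.
exact: (@measurableT_comp _ _ _ _ _ _ (fun x : R => x `^ ((2 * t - 1) / 2))).
Qed.

Variable om : R.
Hypothesis om_ge1 : 1 <= om.
Let om0 : 0 < om. Proof. exact: lt_le_trans om_ge1. Qed.
Let den xi := (xi ^+ 2 + eta) ^+ 2 + om ^+ 2.

Let den_gt0 xi : 0 < den xi.
Proof. by rewrite ltr_wpDl ?sqr_ge0// exprn_gt0. Qed.

Lemma memoryE xi : - (xi ^+ 2 + eta)%:C * memory om xi + (mu xi)%:C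
  = (0 +i* om) * memory om xi.
Proof.
have d0 : (xi ^+ 2 + eta) ^+ 2 + om ^+ 2 != 0 := lt0r_neq0 (den_gt0 xi).
rewrite /memory; simpc; apply/eqP; rewrite eq_complex /=.
by apply/andP; split; apply/eqP; field.
Qed.

Lemma measurable_memory : measurable_fun setT (fun xi => complex.Re (memory om xi))
  /\ measurable_fun setT (fun xi => complex.Im (memory om xi)).
Proof.
have cX : continuous (fun xi : R => xi ^+ 2 + eta).
  by move=> x; apply: cvgD; [apply: cvgM; exact: cvg_id|exact: cvg_cst].
have cd : continuous (fun xi => (den xi)^-1).
  move=> x; apply: cvgV; first by rewrite gt_eqF.
  by apply: cvgD; [apply: cvgM; exact: cX|exact: cvg_cst].
split; (apply: measurable_funM; first exact: measurable_mu_weight);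
  apply: continuous_measurable_fun => x; apply: cvgM;
  by [exact: cX|exact: cvg_cst|exact: cd].
Qed.

Lemma sqr_normc_memory xi : normc (memory om xi) ^+ 2 = mu xi ^+ 2 / den xi.
Proof.
have d0 : (xi ^+ 2 + eta) ^+ 2 + om ^+ 2 != 0 := lt0r_neq0 (den_gt0 xi).
by rewrite normc2E /memory /= /den; field.
Qed.

Let integrable_weight : leb.-integrable setT (fun xi => (weight t om xi)%:E).
Proof.
apply/integrableP; split.
  by apply/measurable_EFinP; exact: measurable_weight.
under eq_integral do rewrite gee0_abs ?lee_fin ?weight_ge0//.
exact: le_lt_trans (integral_weight_le t01 om0) (ltry _).
Qed.

Let integrable_le_weight (h : R -> R) : measurable_fun setT h ->
  (forall xi, `|h xi| <= 2 * weight t om xi) ->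
  leb.-integrable setT (fun xi => (h xi)%:E).
Proof.
move=> mh hw; apply: (@le_integrable _ _ _ _ _ (@measurableT _ (measurableTypeR R)) _
    (fun xi => (2 * weight t om xi)%:E)).
- exact/measurable_EFinP.
- by move=> xi _; rewrite lee_fin (le_trans (hw xi))// ler_norm.
- by under eq_fun do rewrite EFinM; apply: integrableZl.
Qed.

Let weightE xi : weight t om xi = mu xi ^+ 2 / (om + xi ^+ 2).
Proof. by rewrite sqr_mu_weight. Qed.

Let frac_le xi (z : R) : 0 <= z -> (z <= xi ^+ 2 + eta) || (z <= om) ->
  mu xi ^+ 2 * (z / den xi) <= 2 * weight t om xi.
Proof.
move=> z0 zm; rewrite weightE [leRHS]mulrCA ler_wpM2l ?sqr_ge0//.
have N0 : 0 < om + xi ^+ 2 by rewrite ltr_wpDr ?sqr_ge0.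
rewrite ler_pdivlMr// mulrAC ler_pdivrMr// /den.
have := sqr_ge0 xi; move: om0 eta_ge0; set X := xi ^+ 2 => o0 e0 X0.
set Y := X + eta in zm *; have XY : X <= Y by rewrite lerDl.
have sq := sqr_ge0 (Y - om); have Y2 := sqr_ge0 Y.
by case/orP: zm => zm; have : z * (om + X) <= z * (om + Y); nra.
Qed.

Lemma memory_L2 : in_L2_R (memory om).
Proof.
have [mr mi] := measurable_memory; split=> //.
apply: integrable_le_weight; first exact: measurable_normc2.
move=> xi; rewrite ger0_norm ?sqr_ge0// sqr_normc_memory -[_^-1]mul1r frac_le//.
by rewrite om_ge1 orbT.
Qed.

Lemma norm_memory_L2 : in_L2_R (fun xi : R => `|xi|%:C * memory om xi).
Proof.
have [mr mi] := measurable_memory.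
have mr' : measurable_fun setT (fun xi : R => complex.Re (`|xi|%:C * memory om xi)).
  by under eq_fun do rewrite /= mul0r subr0; apply: measurable_funM.
have mi' : measurable_fun setT (fun xi : R => complex.Im (`|xi|%:C * memory om xi)).
  by under eq_fun do rewrite /= mul0r addr0; apply: measurable_funM.
split=> //.
apply: integrable_le_weight; first exact: measurable_normc2.
move=> xi; rewrite ger0_norm ?sqr_ge0// normcM exprMn sqr_normc_memory.
rewrite normc2E /= expr0n addr0 real_normK ?num_real// mulrCA frac_le ?sqr_ge0//.
by rewrite lerDl eta_ge0.
Qed.

Lemma memory_flux_le :
  normc (cintegral leb setT (fun xi => (mu xi)%:C * memory om xi)) <=
  8 / Num.min t (1 - t) * om `^ (t - 1).
Proof.
have [mr mi] := measurable_memory.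
have I4 : \int[leb]_(xi in setT) (2 * weight t om xi) <=
    4 / Num.min t (1 - t) * om `^ (t - 1).
  rewrite RintegralZl//.
  have : \int[leb]_(xi in setT) weight t om xi <=
      2 / Num.min t (1 - t) * om `^ (t - 1).
    rewrite -lee_fin fineK; last exact: integrable_fin_num.
    exact: integral_weight_le.
  rewrite -(ler_pM2l (ltr0n R 2)) => /le_trans; apply.
  by rewrite le_eqVlt; apply/predU1P; left; ring.
have part (h : R -> R) : measurable_fun setT h ->
    (forall xi, `|h xi| <= 2 * weight t om xi) ->
    `|\int[leb]_(xi in setT) h xi| <= 4 / Num.min t (1 - t) * om `^ (t - 1).
  move=> mh hw; have hi := integrable_le_weight mh hw.
  rewrite (le_trans _ I4)// (le_trans (le_normr_Rintegral _ hi))//.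
  apply: le_Rintegral => //; first exact: integrable_norm.
  exact: integrable_mulr.
rewrite (le_trans (normc_le_sum _ _))//.
have -> : 8 / Num.min t (1 - t) * om `^ (t - 1) =
    4 / Num.min t (1 - t) * om `^ (t - 1) + 4 / Num.min t (1 - t) * om `^ (t - 1).
  by ring.
apply: lerD; apply: part.
- under eq_fun do rewrite /= mul0r subr0.
  by apply: measurable_funM => //; exact: measurable_mu_weight.
- move=> xi; rewrite /= mul0r subr0 (mulrA (mu xi) (mu xi)) -expr2.
  rewrite ger0_norm; last first.
    by rewrite mulr_ge0 ?sqr_ge0// divr_ge0 ?addr_ge0 ?sqr_ge0.
  by rewrite -/(den xi) frac_le ?addr_ge0 ?sqr_ge0// lexx.
- under eq_fun do rewrite /= mul0r addr0.
  by apply: measurable_funM => //; exact: measurable_mu_weight.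
- move=> xi; rewrite /= mul0r addr0 (mulrA (mu xi) (mu xi)) -expr2.
  rewrite mulNr mulrN normrN ger0_norm.
    by rewrite -/(den xi) frac_le ?(ltW om0)// lexx orbT.
  by rewrite mulr_ge0 ?sqr_ge0// divr_ge0 ?(ltW om0) ?addr_ge0 ?sqr_ge0.
Qed.

End memory_component.

(** * Quasimodes in the domain of the operator *)

Section domain.
Context (R : realType) (alpha t rho eta : R).
Hypotheses (alpha_gt0 : 0 < alpha) (alpha_lt1 : alpha < 1).
Hypotheses (t01 : 0 < t < 1) (rho_gt0 : 0 < rho) (eta_ge0 : 0 <= eta).
Local Notation beta := (2 - alpha).
Local Notation leb := (@lebesgue_measure R).
Local Notation mu := (mu_weight t).
Local Notation nrm := (Hnorm t rho).
Local Notation mR := (@measurableT _ (measurableTypeR R)).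
Local Notation mI := (@measurable_I01 R).
Local Open Scope complex_scope.

Lemma energy_fst_le (u : Hspace R) : sqnorm leb (@I01 R) (L2rep u.1) <= nrm u ^+ 2.
Proof.
by rewrite sqr_Hnorm// lerDl mulr_ge0 ?sqnorm_ge0// ltW// zeta_gt0.
Qed.

Lemma sqnorm_L2rep0 d (T : measurableType d) (m : {measure set T -> \bar R})
  (D : set T) (mD : measurable D) : sqnorm m D (L2rep (0 : L2 m mD)) = 0.
Proof.
rewrite (sqnorm_ae mD (L2rep_sqint _) _ (@L2rep0 _ _ _ m D mD)).
  rewrite /sqnorm; under eq_Rintegral do rewrite /cst normc0 expr0n.
  by rewrite /Rintegral integral0.
by have /L2predP := (L2pred_submod_closed m mD).1.
Qed.

(** The element U is (v0 + b w, phi), with phi the memory variable for the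
    boundary value 1 and b the flux at 0 that this phi imposes.  Its image is
    written i omega U + (residual, 0), which makes A U - i omega U explicit in the
    quotient.  The last inequality bounds the mass of the mode v0 by the norm of
    U and the sup norm of b w. *)
Lemma quasimode (c C r D : R) (v0 g0 w k : R -> R) :
  1 <= r -> 0 < D -> corrected_mode alpha c C r D v0 g0 w k ->
  exists (b : R[i]) (U F : Hspace R),
  [/\ opA alpha t rho eta U F,
      normc b <= zeta t rho * (8 / Num.min t (1 - t) * (r `^ beta) `^ (t - 1)),
      nrm (F - (0 +i* (r `^ beta)) *: U) ^+ 2 = normc b ^+ 2 * (beta / D) &
      D / beta <= 2 * nrm U ^+ 2 + 2 * (normc b * (C * r `^ (alpha - 1))) ^+ 2].
Proof.
move=> r1 D0 [mode corr [v00 g00] [w00 k00] g01 k01 wC mass _].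
have r0 := lt_le_trans ltr01 r1.
have b0 : 0 < beta by move: alpha_lt1; lra.
set om := r `^ beta in mode corr *.
have om1 : 1 <= om.
  by rewrite -[leLHS](powRr0 r); apply: ler_powR => //; exact: ltW.
pose phi := memory t eta om.
have phiL : in_L2_R phi := memory_L2 t01 eta_ge0 om1.
pose b : R[i] := 'i * (zeta t rho)%:C *
  cintegral leb setT (fun xi => (mu xi)%:C * phi xi).
have bE : b = 'i * (zeta t rho)%:C *
  cintegral leb setT (fun xi => (mu xi)%:C * phi xi) by [].
(* opaque from here on: simplification must not unfold the integral *)
clearbody b.
pose b1 := complex.Re b; pose b2 := complex.Im b.
have [v0c g0c _ _] := mode; have [wc kc _ _] := corr.
pose s : R := beta / D.
pose e1 x := - (om * v0 x) + b1 * (- (om * w x) - s * v0 x).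
pose e2 x := 0 + b2 * (- (om * w x) - s * v0 x).
pose v := cpx (fun x => v0 x + b1 * w x) (fun x => 0 + b2 * w x).
pose g := cpx (fun x => g0 x + b1 * k x) (fun x => 0 + b2 * k x).
have ode0 : flux_ode alpha (fun=> 0) (fun=> 0) (fun=> 0).
  split=> [x|x|x _|x _]; [exact: cvg_cst|exact: cvg_cst| |exact: is_derive_cst].
  by rewrite mul0r; exact: is_derive_cst.
have ode1 := flux_ode_lin b1 mode corr.
have ode2 := flux_ode_lin b2 ode0 corr.
have cs (a : R) (h : R -> R) : continuous h -> continuous (fun x => a * h x).
  by move=> hc x; apply: cvgM; [exact: cvg_cst|exact: hc].
have cf : continuous (fun x => - (om * w x) - s * v0 x).
  move=> x; apply: cvgB; last exact: (cs s v0 v0c x).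
  by apply: cvgN; exact: (cs om w wc x).
have e1c : continuous e1.
  move=> x; apply: cvgD; last exact: (cs b1 _ cf x).
  by apply: cvgN; exact: (cs om v0 v0c x).
have e2c : continuous e2.
  by move=> x; apply: cvgD; [exact: cvg_cst|exact: (cs b2 _ cf x)].
have H2 := in_H2_alpha_flux_ode alpha_gt0 alpha_lt1 e1c ode1 e2c ode2.
rewrite -/v -/g in H2.
have [[vL _ _ _] _ _] := H2.
pose res := cpx (fun x => - (s * b2) * v0 x) (fun x => s * b1 * v0 x).
have resL : in_L2_01 res by apply: in_L2_01_continuous; exact: cs.
have vP : v \in L2pred leb mI by exact/L2predP.
have rP : res \in L2pred leb mI by exact/L2predP.
have pP : phi \in L2pred leb mR by exact/L2predP.
pose up : L2_R R := class_of pP (mD := mR).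
pose U : Hspace R := (class_of vP (mD := mI), up).
pose F : Hspace R := (0 +i* om) *: U + ((class_of rP (mD := mI), 0) : Hspace R).
have mv0 : measurable_fun setT (EFin \o (fun x => v0 x ^+ 2)).
  by apply/measurable_EFinP; apply: measurable_funX;
    exact: continuous_measurable_fun.
have mass01 : \int[leb]_(x in @I01 R) (v0 x ^+ 2) = D / beta.
  rewrite /Rintegral /I01 integral_itv_bndo_bndc; last exact: measurable_funTS.
  by rewrite integral_itv_obnd_cbnd ?mass//; exact: measurable_funTS.
have v0i : leb.-integrable (@I01 R) (EFin \o (fun x => v0 x ^+ 2)).
  have z0c : continuous (fun _ : R => 0 : R) by move=> x; exact: cvg_cst.
  have [_ _ +] := in_L2_01_continuous v0c z0c.
  apply: (eq_integrable mI) => x _ /=.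
  by rewrite expr0n addr0 sqr_sqrtr ?sqr_ge0.
have resE x : normc (res x) ^+ 2 = (- (s * b2) * v0 x) ^+ 2 + (s * b1 * v0 x) ^+ 2
  by exact: normc2E.
have vE x : normc (v x) ^+ 2 = (v0 x + b1 * w x) ^+ 2 + (0 + b2 * w x) ^+ 2
  by exact: normc2E.
have pae := L2rep_class pP (mD := mR).
have pL := L2rep_sqint up.
have [pr pi _] := pL.
have mm := @measurable_mu_weight R t.
have X1c : continuous (fun xi : R => - (xi ^+ 2 + eta)).
  move=> x; apply: cvgN; apply: cvgD; last exact: cvg_cst.
  by apply: cvgM; exact: cvg_id.
have mX1 : measurable_fun setT (fun xi : R => - (xi ^+ 2 + eta)).
  exact: continuous_measurable_fun.
have v01 : v 0 = 1.
  by rewrite /v /cpx v00 w00 !mulr0 !addr0.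
have phiE xi : phi_part t eta v phi xi = (0 +i* om) * phi xi.
  by rewrite /phi_part v01 mulr1 memoryE.
pose pU : R -> R[i] := L2rep U.2.
have phi_part_ae : phi_part t eta v pU =
    (fun xi => (0 +i* om) * phi xi) %[ae leb in setT].
  apply: (@ae_eq_on _ _ _ leb setT _ (phi_part t eta v phi)) => //.
  pose j (xi : R) (z : R[i]) :=
    - (xi ^+ 2 + eta)%:C * z + (mu_weight t xi)%:C * v 0.
  exact: (ae_eq_comp2 (j : measurableTypeR R -> R[i] -> R[i]) pae).
have phi_partL : in_L2_R (phi_part t eta v pU).
  apply: (sqint_ae mR (sqintZ mR (0 +i* om) phiL)); last exact: ae_eq_sym.
  - under eq_fun do rewrite /phi_part v01 mulr1 -rmorphN raddfD /= Re_realM.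
    by apply: measurable_funD => //; apply: measurable_funM.
  - under eq_fun do rewrite /phi_part v01 mulr1 -rmorphN raddfD /= Im_realM addr0.
    by apply: measurable_funM.
have abs_pL : in_L2_R (fun xi : R => `|xi|%:C * pU xi).
  apply: (sqint_ae mR (norm_memory_L2 t01 eta_ge0 om1)).
  - by under eq_fun do rewrite Re_realM; apply: measurable_funM.
  - by under eq_fun do rewrite Im_realM; apply: measurable_funM.
  - by apply: ae_eq_sym; exact: (ae_eq_comp2
      ((fun (xi : R) z => `|xi|%:C * z) : measurableTypeR R -> R[i] -> R[i]) pae).
exists b, U, F; split.
- exists v, g; split.
  + split => //.
    * exact: L2rep_class.
    * by rewrite /g /cpx /= g01 k01 !mulr0 !addr0.
    * rewrite (cintegral_weighted_ae mR mm pL phiL pae) -bE /g /cpx /=.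
      by rewrite g00 k00 !mulr1 !add0r; apply/eqP; rewrite eq_complex /= !eqxx.
  + have := L2rep_lin (0 +i* om) (L2rep_class vP (mD := mI)) (L2rep_class rP (mD := mI)).
    move=> /ae_eq_on; apply => x; rewrite /I01 /= in_itv/= => /andP[x0 _].
    have [_ _ _ dg1] := ode1; have [_ _ _ dg2] := ode2.
    rewrite (cderive_cpx dg1 dg2 x0) /v /res /cpx /s.
    by simpc; congr (_ +i* _); ring.
  + apply: ae_eq_trans (ae_eq_sym phi_part_ae).
    have := L2rep_lin (0 +i* om) pae (@L2rep0 _ _ _ leb setT mR).
    by move=> /ae_eq_on; apply => x _; rewrite /= addr0.
- rewrite bE normcM normcM /= expr0n expr1n add0r sqrtr1 mul1r addr0.
  rewrite sqrtr_sqr gtr0_norm ?zeta_gt0// ler_wpM2l ?(ltW (zeta_gt0 t01 rho_gt0))//.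
  exact: memory_flux_le.
- rewrite [F]/(_ + _) addrC addKr sqr_Hnorm// /energy /= sqnorm_L2rep0 mulr0 addr0.
  rewrite (sqnorm_ae mI (L2rep_sqint _) resL (L2rep_class rP (mD := mI))) /sqnorm.
  transitivity (\int[leb]_(x in @I01 R) (s ^+ 2 * normc b ^+ 2 * v0 x ^+ 2)).
    by apply: eq_Rintegral => x _; rewrite resE [in RHS]normc2E -/b1 -/b2; ring.
  rewrite (RintegralZl _ mI v0i) mass01 /s; field.
  by rewrite !gt_eqF.
- rewrite -mass01.
  have [_ _ vi] := vL.
  set B := C * r `^ (alpha - 1); pose P := (normc b * B) ^+ 2.
  have UL := energy_fst_le U; rewrite (_ : sqnorm _ _ _ =
      \int[leb]_(x in @I01 R) (normc (v x) ^+ 2)) in UL; last first.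
    by rewrite (sqnorm_ae mI (L2rep_sqint _) vL (L2rep_class vP (mD := mI))).
  have I1 : leb.-integrable (@I01 R) (EFin \o (fun x => 2 * normc (v x) ^+ 2)).
    exact: (integrable_mulr mI).
  have I2 : leb.-integrable (@I01 R) (EFin \o (fun=> 2 * P)).
    apply: (@integrable_I01_le _ _ `|2 * P| 0) => // x _.
    by rewrite oppr0 powRr0 mulr1.
  have I12 : leb.-integrable (@I01 R) (EFin \o (fun x => 2 * normc (v x) ^+ 2 + 2 * P)).
    by have := integrableD mI I1 I2; apply: eq_integrable mI _ _ _.
  have leb1 : fine (leb (@I01 R)) = 1.
    by rewrite /I01 lebesgue_measure_itv/= lte_fin ltr01 oppr0 adde0.
  apply: (@le_trans _ _ (\int[leb]_(x in @I01 R) (2 * normc (v x) ^+ 2 + 2 * P))).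
    apply: (le_Rintegral mI v0i I12) => x; rewrite /I01 /= in_itv/= => /andP[x0 x1].
    have wB : `|w x| <= B by apply: wC; rewrite !ltW.
    have : (b1 ^+ 2 + b2 ^+ 2) * w x ^+ 2 <= P.
      rewrite /P exprMn normc2E -/b1 -/b2 ler_wpM2l ?addr_ge0 ?sqr_ge0//.
      rewrite -[leLHS]real_normK ?num_real// lerXn2r ?nnegrE//.
      exact: le_trans wB.
    rewrite vE => wP.
    have := sqr_ge0 (v0 x + 2 * b1 * w x); have := sqr_ge0 (b2 * w x).
    move: wP; set W := w x; set V := v0 x; nra.
  rewrite (RintegralD mI I1 I2) (RintegralZl _ mI vi) (Rintegral_cst leb mI).
  rewrite [fine _]leb1 mulr1.
  by rewrite lerD2r ler_wpM2l.
Qed.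

End domain.

(** * Failure of exponential stability *)

Theorem theorem5p1 (R : realType) (alpha talpha rho eta : R)
    (alpha_gt0 : 0 < alpha) (alpha_lt1 : alpha < 1)
    (talpha_gt0 : 0 < talpha) (talpha_lt1 : talpha < 1)
    (rho_gt0 : 0 < rho) (eta_ge0 : 0 <= eta)
    (talpha_lt : talpha < (4 - 3 * alpha) / (2 * (2 - alpha)))
    (T : R -> Hspace R -> Hspace R)
    (T_semigroup :
       generates (Hnorm talpha rho) (opA alpha talpha rho eta) T) :
  ~ exponentially_stable (Hnorm talpha rho) T.
Proof.
move=> stable.
have t01 : 0 < talpha < 1 by rewrite talpha_gt0.
have [C1 C10 lower] := resolvent_lower_bound (HnormD t01 rho_gt0)
  (HnormZ talpha rho) (Hnorm_ge0 talpha rho) T_semigroup stable.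
have [c [C [c0 C0 modes]]] := corrected_modes alpha_gt0 alpha_lt1.
pose beta := 2 - alpha; have b0 : 0 < beta by rewrite /beta; lra.
pose K := zeta talpha rho * (8 / Num.min talpha (1 - talpha)).
(* minus the exponent of r in the relative size of the residual *)
pose eps := (1 - talpha) * beta - alpha / 2.
have eps0 : 0 < eps.
  move: talpha_lt; rewrite ltr_pdivlMr; last by rewrite mulr_gt0.
  by rewrite /eps /beta; lra.
pose M := 2 * C1 ^+ 2 * beta / c + 2 * C ^+ 2.
have M0 : 0 <= M.
  apply: addr_ge0; last exact: mulr_ge0 (ler0n _ 2) (sqr_ge0 _).
  apply: divr_ge0 (ltW c0); apply: mulr_ge0 (ltW b0).
  exact: mulr_ge0 (ler0n _ 2) (sqr_ge0 _).
(* large enough for c / beta <= (K / X)^2 M to fail *)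
pose X := K ^+ 2 * M * beta / c + 1.
have X1 : 1 <= X.
  rewrite lerDr; apply: divr_ge0 (ltW c0); apply: mulr_ge0 (ltW b0).
  exact: mulr_ge0 (sqr_ge0 _) M0.
have X0 : 0 < X := lt_le_trans ltr01 X1.
have [r [D [v [g [w [k [Br r1 mode]]]]]]] := modes (X `^ eps^-1).
have r0 := lt_le_trans ltr01 r1.
have cD := mode_mass_ge mode; set q := r `^ (alpha / 2) in cD.
have q0 : 0 < q by rewrite powR_gt0.
have q1 : 1 <= q.
  by rewrite -[leLHS](powRr0 r) ler_powR// divr_ge0 ?(ltW alpha_gt0).
have D0 : 0 < D by rewrite -(pmulr_rgt0 _ q0) (lt_le_trans c0).
have [b [U [F [UF nb res mass]]]] :=
  quasimode alpha_gt0 alpha_lt1 t01 rho_gt0 eta_ge0 r1 D0 mode.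
have {}lower := lower (r `^ (2 - alpha)) _ _ UF.
set nU := Hnorm talpha rho U in lower mass.
set nF := Hnorm talpha rho (F - _) in lower res.
set B := normc b in nb res mass.
have B0 : 0 <= B by exact: Defs.normc_ge0.
have lower2 : nU ^+ 2 <= C1 ^+ 2 * (B ^+ 2 * (beta / D)).
  have nF0 : 0 <= nF by exact: Hnorm_ge0.
  rewrite -res -exprMn lerXn2r ?nnegrE ?mulr_ge0 ?(ltW C10)//.
  exact: Hnorm_ge0.
have ra : (C * r `^ (alpha - 1)) ^+ 2 <= C ^+ 2.
  rewrite lerXn2r ?nnegrE ?mulr_ge0 ?powR_ge0 ?(ltW C0)//.
  by rewrite ler_piMr ?(ltW C0)// -[leRHS](powRr0 r) ler_powR//; lra.
have Dq : D^-1 <= q / c by rewrite ler_pdivlMr// mulrC ler_pdivrMr.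
have bound : c / beta <= (B * q) ^+ 2 * M.
  have m1 : D / beta <= 2 * (C1 ^+ 2 * (B ^+ 2 * (beta * (q / c)))) +
      2 * (B ^+ 2 * C ^+ 2).
    apply: (le_trans mass); apply: lerD.
      rewrite ler_wpM2l// (le_trans lower2)// ler_wpM2l ?sqr_ge0//.
      by rewrite ler_wpM2l ?sqr_ge0// ler_wpM2l// ltW.
    by rewrite ler_wpM2l// exprMn ler_wpM2l ?sqr_ge0.
  apply: (@le_trans _ _ (q * (D / beta))).
    by rewrite mulrA ler_wpM2r// invr_ge0 ltW.
  apply: (le_trans (ler_wpM2l (ltW q0) m1)).
  have -> : (B * q) ^+ 2 * M =
      q * (2 * (C1 ^+ 2 * (B ^+ 2 * (beta * (q / c)))) +
           2 * (B ^+ 2 * C ^+ 2) * q).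
    by rewrite /M; ring.
  rewrite ler_wpM2l ?(ltW q0)// lerD2l ler_peMr//.
  by apply: mulr_ge0 => //; apply: mulr_ge0; exact: sqr_ge0.
have rX : X <= r `^ eps.
  rewrite -[leLHS](powRr1 (ltW X0)) -(mulVf (lt0r_neq0 eps0)) powRrM.
  by rewrite ge0_ler_powR ?nnegrE ?powR_ge0 ?(ltW eps0) ?(ltW r0).
have K0 : 0 <= K.
  rewrite /K; apply: mulr_ge0; first exact: ltW (zeta_gt0 t01 rho_gt0).
  by rewrite divr_ge0// le_min (ltW talpha_gt0) subr_ge0 ltW.
have Bq : B * q <= K / X.
  apply: (@le_trans _ _ (K * r `^ (- eps))).
    have -> : r `^ (- eps) = (r `^ beta) `^ (talpha - 1) * q.
      rewrite /q -powRrM -powRD ?(gt_eqF r0) ?implybT//.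
      by congr (_ `^ _); rewrite /eps; ring.
    by rewrite mulrA ler_wpM2r ?(ltW q0)// /K -mulrA.
  by rewrite powRN ler_wpM2l// lef_pV2 ?posrE ?powR_gt0.
have Bq0 : 0 <= B * q by rewrite mulr_ge0// ltW.
have : c / beta <= K ^+ 2 / X ^+ 2 * M.
  apply: (le_trans bound); rewrite ler_wpM2r// -expr_div_n lerXn2r ?nnegrE//.
  exact: le_trans Bq.
rewrite mulrAC ler_pdivlMr ?exprn_gt0// mulrAC ler_pdivrMr// mulrC.
rewrite -ler_pdivlMr// => XX.
have : X ^+ 2 <= X - 1 by rewrite /X addrK.
by move: X1; nra.
Qed.
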